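(* Let $H$ be a separable complex Hilbert space. Then the set $$\{T\in\mathcal{B}(H):\ \sigma_c(T)=\emptyset\}$$ is dense in $\mathcal{B}(H)$ with respect to the operator norm topology.
   Context: $\mathcal{B}(H)$ is the algebra of bounded linear operators on $H$, $\sigma(T)$ is the spectrum of $T$, and the point spectrum $\sigma_p(T)$ is the set of all $\lambda\in\mathbb{C}$ with $\ker(T-\lambda\,\mathrm{id}_H)\neq\{0\}$. The continuous spectrum is $\sigma_c(T)=\sigma(T)\setminus\big(\sigma_p(T)\cup\overline{\sigma_p(T^* )}\big)$, where $T^*$ is the adjoint of $T$ and the bar denotes complex conjugation of the elements, $\overline{\sigma_p(T^* )}=\{\bar\mu:\mu\in\sigma_p(T^* )\}$. Equivalently, $\lambda\in\sigma_c(T)$ if and only if $\ker(T-\lambda\,\mathrm{id}_H)=\ker(T^*-\bar\lambda\,\mathrm{id}_H)=\{0\}$ and the image of $T-\lambda\,\mathrm{id}_H$ is not closed. *)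

(* Defs.v *)
From HB Require Import structures.
From mathcomp Require Import all_boot all_order all_algebra.
From mathcomp Require Import sesquilinear.
From mathcomp Require Import complex.
From mathcomp Require Import all_classical all_reals all_analysis.
From mathcomp Require Import ring lra.

Set Implicit Arguments.
Unset Strict Implicit.
Unset Printing Implicit Defensive.

Import Order.TTheory GRing.Theory Num.Theory.
Import numFieldNormedType.Exports.

Local Open Scope classical_set_scope.
Local Open Scope ring_scope.
Local Open Scope complex_scope.

(* [{dot H for Num.conj}] is linear in its first argument and conjugate-linear
   in its second one.  Norms live in R[i] but are real and nonnegative. *)
HB.mixin Record NormedModule_isInnerProduct (R : realType) H
    & NormedModule R[i] H := {
  inner : {dot H for Num.conj} ;
  normr_inner : forall x : H, `|x| ^+ 2 = inner x x
}.

#[short(type="hilbertType")]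
HB.structure Definition Hilbert (R : realType) :=
  {H of CompleteNormedModule R[i] H & NormedModule_isInnerProduct R H}.

Section BoundedOperator.
Context {R : realType} (H : hilbertType R).

Definition bounded_linear : {pred H -> H} :=
  mem [set f : H -> H | linear f /\ continuous f].

Lemma bounded_linearP (f : H -> H) :
  reflect (linear f /\ continuous f) (f \in bounded_linear).
Proof. by apply: (iffP idP); rewrite inE. Qed.

Lemma bounded_linear_submod : submod_closed bounded_linear.
Proof.
split => [|a f g /bounded_linearP[lf cf] /bounded_linearP[lg cg]].
  apply/bounded_linearP; split => [a x y|]; last by move=> x; exact: cvg_cst.
  by rewrite /= scaler0 addr0.
apply/bounded_linearP; split=> [b x y|x].
  rewrite !fctE lf lg !scalerDr !scalerA [b * a]mulrC.
  by rewrite addrACA.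
by apply: cvgD; [apply: cvgZl_tmp; exact: cf|exact: cg].
Qed.

HB.instance Definition _ :=
  GRing.isSubmodClosed.Build R[i] (H -> H) bounded_linear bounded_linear_submod.

(* The algebra B(H), as an R[i]-module with pointwise operations. *)
Record bounded_op := BoundedOp { bop_fun :> H -> H ; _ : bop_fun \in bounded_linear }.

HB.instance Definition _ := [isSub for bop_fun].
HB.instance Definition _ := [Choice of bounded_op by <:].
HB.instance Definition _ := [SubChoice_isSubLmodule of bounded_op by <:].
End BoundedOperator.

Section OperatorNorm.
Context {R : realType} {H : hilbertType R}.
Implicit Types (T S : bounded_op H) (x : H).

HB.instance Definition _ T := GRing.isLinear.Build R[i] H H *:%R (bop_fun T)
  (proj1 (bounded_linearP _ (valP T))).

Lemma bop_continuous T : continuous T.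
Proof. by have /bounded_linearP[] := valP T. Qed.

Lemma bop_ext T S : (forall x, T x = S x) -> T = S.
Proof. by move=> TS; apply/val_inj/funext. Qed.

Lemma bop_addE T S x : (T + S) x = T x + S x.
Proof. by []. Qed.

Lemma bop_scaleE (a : R[i]) T x : (a *: T) x = a *: T x.
Proof. by []. Qed.

Lemma bop_zeroE x : (0 : bounded_op H) x = 0.
Proof. by []. Qed.

Lemma bop_oppE T x : (- T) x = - T x.
Proof. by []. Qed.

Definition opnorm T : R :=
  sup [set complex.Re `|T x| | x in [set x : H | `|x| <= 1]].

Lemma normcRe x : `|x| = (complex.Re `|x|)%:C.
Proof.
by have := normr_ge0 x; case: `|x| => a b; rewrite lecE /= => /andP[/eqP-> _].
Qed.

Lemma bop_bounded T : exists2 M : R, 0 <= M & forall x, `|T x| <= M%:C * `|x|.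
Proof.
have /linear_bounded_continuous/linear_boundedP := @bop_continuous T.
move=> /pinfty_ex_gt0[M M0 TM]; exists (complex.Re M).
  by move: M0; rewrite ltcE => /andP[_ /ltW].
suff -> : (complex.Re M)%:C = M by [].
by case: M M0 {TM} => a b; rewrite ltcE /= => /andP[/eqP->].
Qed.

Lemma opnorm_has_sup T :
  has_sup [set complex.Re `|T x| | x in [set x : H | `|x| <= 1]].
Proof.
split; first by exists (complex.Re `|T 0|), 0 => //=; rewrite normr0 ler01.
have [M M0 TM] := bop_bounded T; exists M => _ [x /= x1 <-].
rewrite -lecR -normcRe (le_trans (TM x))// -[leRHS]mulr1 ler_wpM2l//.
by rewrite (lecR 0).
Qed.

Lemma opnormP T x : `|T x| <= (opnorm T)%:C * `|x|.
Proof.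
have [->|x0] := eqVneq x 0; first by rewrite raddf0 !normr0 mulr0.
have nx : 0 < `|x| by rewrite normr_gt0.
rewrite -ler_pdivrMr// mulrC -[`|x|^-1]gtr0_norm ?invr_gt0// -normrZ -linearZ.
rewrite [leLHS]normcRe lecR; apply: (sup_upper_bound (opnorm_has_sup T)).
exists (`|x|^-1 *: x) => //=.
by rewrite normrZ gtr0_norm ?invr_gt0// mulVf ?gt_eqF.
Qed.

Lemma opnorm_le T (M : R) :
  (forall x, `|x| <= 1 -> `|T x| <= M%:C) -> opnorm T <= M.
Proof.
move=> TM; apply: ge_sup; first by case: (opnorm_has_sup T).
by move=> _ [x x1 <-]; rewrite -lecR -normcRe; exact: TM.
Qed.

Lemma opnorm_ge0 T : 0 <= opnorm T.
Proof.
apply: (sup_upper_bound (opnorm_has_sup T)); exists 0 => /=.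
  by rewrite normr0 ler01.
by rewrite raddf0 normr0.
Qed.

Lemma opnormP1 T x : `|x| <= 1 -> `|T x| <= (opnorm T)%:C.
Proof.
move=> x1; apply: le_trans (opnormP T x) _.
by rewrite -[leRHS]mulr1 ler_wpM2l// (lecR 0) opnorm_ge0.
Qed.

Let opnormD T S : (opnorm (T + S))%:C <= (opnorm T)%:C + (opnorm S)%:C.
Proof.
rewrite -rmorphD lecR; apply: opnorm_le => x x1.
by rewrite rmorphD (le_trans (ler_normD _ _))// lerD ?opnormP1.
Qed.

Let opnormZ_le (a : R[i]) T : (opnorm (a *: T))%:C <= `|a| * (opnorm T)%:C.
Proof.
rewrite [`|a|](_ : _ = (complex.Re `|a|)%:C)//.
rewrite -rmorphM lecR; apply: opnorm_le => x x1.
by rewrite bop_scaleE normrZ rmorphM/= ler_wpM2l ?opnormP1.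
Qed.

Let opnormZ (a : R[i]) T : (opnorm (a *: T))%:C = `|a| * (opnorm T)%:C.
Proof.
apply/le_anti; rewrite opnormZ_le/=.
have [->|a0] := eqVneq a 0.
  by rewrite normr0 mul0r (lecR 0) opnorm_ge0.
rewrite mulrC -ler_pdivlMr ?normr_gt0// mulrC -normfV.
by rewrite -[in leLHS](scalerK a0 T) opnormZ_le.
Qed.

Let opnorm_eq0 T : (opnorm T)%:C = 0 -> T = 0.
Proof.
move=> T0; apply: bop_ext => x; apply/eqP; rewrite -normr_le0.
by rewrite (le_trans (opnormP _ _))// T0 mul0r.
Qed.

(* B(H) carries the topology induced by the operator norm. *)
HB.instance Definition _ := @Lmodule_isNormed.Build R[i] (bounded_op H)
  (fun T => (opnorm T)%:C) opnormD opnormZ opnorm_eq0.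

Lemma bop_normE T : `|T| = (opnorm T)%:C.
Proof. by []. Qed.

End OperatorNorm.

Section Adjoint.
Context {R : realType} {H : hilbertType R}.
Implicit Types (T S : bounded_op H) (x y z v : H).
Local Notation "'[ x , y ]" := (inner x y).

Lemma innerC x y : '[x, y] = Num.conj '[y, x].
Proof. by rewrite hermC expr0 mul1r. Qed.

Lemma inner_norm x : '[x, x] = `|x| ^+ 2.
Proof. by rewrite normr_inner. Qed.

Lemma innerDl x y z : '[x + y, z] = '[x, z] + '[y, z].
Proof. exact: linearDl. Qed.

Lemma innerZl (a : R[i]) x y : '[a *: x, y] = a * '[x, y].
Proof. exact: linearZl_LR. Qed.

Lemma innerDr x y z : '[x, y + z] = '[x, y] + '[x, z].
Proof. exact: linearDr. Qed.

Lemma innerZr (a : R[i]) x y : '[x, a *: y] = Num.conj a * '[x, y].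
Proof. by rewrite innerC innerZl rmorphM/= -innerC. Qed.

Lemma innerBl x y z : '[x - y, z] = '[x, z] - '[y, z].
Proof. exact: linearBl. Qed.

Lemma innerBr x y z : '[x, y - z] = '[x, y] - '[x, z].
Proof. exact: linearBr. Qed.

Lemma inner_eq x y : (forall z, '[z, x] = '[z, y]) -> x = y.
Proof.
move=> xy; apply/eqP; rewrite -subr_eq0 -normr_eq0 -sqrf_eq0.
by rewrite -inner_norm innerBr xy subrr.
Qed.

Lemma parallelogram x y :
  `|x + y| ^+ 2 + `|x - y| ^+ 2 = 2 * `|x| ^+ 2 + 2 * `|y| ^+ 2.
Proof.
rewrite -!inner_norm !(innerBl, innerBr, innerDl, innerDr).
by ring.
Qed.

Lemma norm_rejection x y : `| `|y| ^+ 2 *: x - '[x, y] *: y| ^+ 2 =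
  `|y| ^+ 2 * (`|x| ^+ 2 * `|y| ^+ 2 - `|'[x, y]| ^+ 2).
Proof.
set c := '[x, y]; rewrite -[LHS]inner_norm.
rewrite !(innerBl, innerBr, innerZl, innerZr) -/c (innerC y x) -/c.
rewrite !inner_norm normCK rmorphXn/= (conj_Creal (normr_real y)).
by ring.
Qed.

Lemma cauchy_schwarz x y : `|'[x, y]| <= `|x| * `|y|.
Proof.
have [->|y0] := eqVneq y 0.
  have := innerZr 0 x 0; rewrite scale0r rmorph0 mul0r => ->.
  by rewrite !normr0 mulr0.
have ny : 0 < `|y| by rewrite normr_gt0.
rewrite -(@ler_pXn2r _ 2)// ?nnegrE ?mulr_ge0// exprMn.
have : 0 <= `| `|y| ^+ 2 *: x - '[x, y] *: y| ^+ 2 by rewrite exprn_ge0.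
by rewrite norm_rejection pmulr_rge0 ?exprn_gt0// subr_ge0.
Qed.

Section Riesz.
Variables (f : H -> R[i]) (M : R).
Hypothesis f_lin : forall a x y, f (a *: x + y) = a * f x + f y.
Hypothesis M_ge0 : 0 <= M.
Hypothesis f_bnd : forall x, `|f x| <= M%:C * `|x|.

Let fD x y : f (x + y) = f x + f y.
Proof. by rewrite -[x]scale1r f_lin mul1r scale1r. Qed.

Let f0 : f 0 = 0.
Proof. by apply: (addIr (f 0)); rewrite -fD !add0r. Qed.

Let fZ a x : f (a *: x) = a * f x.
Proof. by rewrite -[a *: x]addr0 f_lin f0 addr0. Qed.

Let fB x y : f (x - y) = f x - f y.
Proof. by rewrite fD -scaleN1r fZ mulN1r. Qed.

Let A := [set x | f x = 1].
Let N x : R := complex.Re `|x|.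

Let N_ge0 x : 0 <= N x.
Proof. by rewrite -lecR -normcRe; exact: normr_ge0. Qed.

Let minimizer : A !=set0 ->
  exists2 v, f v = 1 & forall w, f w = 1 -> `|v| <= `|w|.
Proof.
move=> [x0 Ax0]; pose d := inf (N @` A).
have hinf : has_inf (N @` A).
  by split; [exists (N x0), x0|exists 0 => _ [x _ <-]; exact: N_ge0].
have d_ge0 : 0 <= d.
  by apply: lb_le_inf; [exact: hinf.1|move=> _ [x _ <-]; exact: N_ge0].
have dN x : A x -> d <= N x.
  by move=> Ax; apply: (ge_inf hinf.2); exists x.
pose B e := [set x | A x /\ N x < d + e].
have B0 e : 0 < e -> B e !=set0.
  move=> e0; have [_ [x Ax <-] xe] := inf_adherent e0 hinf.
  by exists x.
have BB e1 e2 : e1 <= e2 -> B e1 `<=` B e2.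
  by move=> e12 x [Ax Nx]; split => //; rewrite (lt_le_trans Nx)// lerD2l.
pose F : set_system H := filter_from [set e : R | 0 < e] B.
have FF : ProperFilter F.
  apply: filter_from_proper; last by move=> e; exact: B0.
  apply: filter_from_filter; first by exists 1; exact: ltr01.
  move=> i j i0 j0; exists (Num.min i j); first by rewrite /= lt_min i0.
  by rewrite subsetI; split; apply: BB; rewrite ge_min lexx ?orbT.
have par x y : N (x + y) ^+ 2 + N (x - y) ^+ 2 = 2 * N x ^+ 2 + 2 * N y ^+ 2.
  apply: (@complexI R); rewrite !rmorphD !rmorphM rmorphD rmorph1 -!expr2 /=.
  by rewrite /N -!normcRe parallelogram.
have Bdist e x y : 0 < e -> e <= 1 -> B e x -> B e y ->
    N (x - y) ^+ 2 <= (8 * d + 4) * e.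
  move=> e0 e1 [Ax Nx] [Ay Ny].
  have Axy : A (2^-1 *: (x + y)).
    by rewrite /A/= fZ fD Ax Ay mulVf// pnatr_eq0.
  have dxy : 2 * d <= N (x + y).
    have := dN _ Axy; rewrite /N -lecR -normcRe normrZ ger0_norm ?invr_ge0//.
    rewrite ler_pdivlMl ?ltr0n// (normcRe (x + y)).
    by rewrite -[2]/(2%:R) -(rmorph_nat (real_complex R)) -rmorphM lecR.
  have := par x y; have := N_ge0 x; have := N_ge0 y.
  by nra.
have FC : cauchy F.
  apply: cauchy_exP => eps eps0.
  have [e e0 epsE] : exists2 e : R, 0 < e & eps = e%:C.
    case: eps eps0 => a b; rewrite ltcE/= => /andP[/eqP-> a0].
    by exists a.
  pose e' := Num.min 1 (e ^+ 2 / (8 * d + 5)).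
  have d5 : 0 < 8 * d + 5 by lra.
  have e'0 : 0 < e' by rewrite lt_min ltr01 divr_gt0 ?exprn_gt0.
  have [x Bx] := B0 _ e'0; exists x; exists e' => // y By.
  rewrite -ball_normE/= normcRe epsE ltcR -/(N _).
  have e'1 : e' <= 1 by rewrite ge_min lexx.
  have e'e : e' <= e ^+ 2 / (8 * d + 5) by rewrite ge_min lexx orbT.
  rewrite -(@ltr_pXn2r _ 2)// ?nnegrE ?N_ge0// ?ltW//.
  rewrite (le_lt_trans (Bdist _ _ _ e'0 e'1 Bx By))//.
  by move: e'e; rewrite ler_pdivlMr//; nra.
have [v Fv] : exists v, F --> v by apply/cvg_ex; apply: cauchy_cvg.
have near_v e : 0 < e -> exists x, [/\ A x, N (v - x) < e & N x < d + e].
  move=> e0; have [e1 e10 Be1] : F (ball v e%:C).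
    by apply: Fv; apply: nbhsx_ballx; rewrite (ltcR 0).
  have m0 : 0 < Num.min e e1 by rewrite lt_min e0.
  have [x Bx] := B0 _ m0; exists x.
  have [Ax Nx] : B e x by apply: BB Bx; rewrite ge_min lexx.
  split => //; have : ball v e%:C x.
    by apply: Be1; apply: BB Bx; rewrite ge_min lexx orbT.
  by rewrite -ball_normE/= normcRe ltcR.
exists v.
  apply/eqP; rewrite -subr_eq0 -normr_le0; apply/ler_addgt0Pl => eps eps0.
  have [e e0 epsE] : exists2 e : R, 0 < e & eps = e%:C.
    case: eps eps0 => a b; rewrite ltcE/= => /andP[/eqP-> a0].
    by exists a.
  have M1 : 0 < M + 1 by rewrite ltr_wpDl.
  have [x [Ax vx _]] := near_v (e / (M + 1)) (divr_gt0 e0 M1).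
  rewrite addr0 -Ax -fB (le_trans (f_bnd _))// normcRe -rmorphM epsE lecR.
  rewrite -/(N _); move: vx; rewrite ltr_pdivlMr//.
  by have := N_ge0 (v - x); nra.
move=> w /dN; rewrite normcRe (normcRe w) lecR; apply: le_trans.
apply/ler_addgt0Pr => e e0.
have e20 : 0 < e / 2 by rewrite divr_gt0.
have [x [_ vx xd]] := near_v _ e20.
have : N v <= N (v - x) + N x.
  by rewrite -lecR rmorphD/= -!normcRe -{1}(subrK x v) ler_normD.
by rewrite -/(N v); lra.
Qed.

Lemma riesz_representation : exists v, forall x, f x = '[x, v].
Proof.
have [[x0 fx0]|/forallNP f_eq0] := pselect (exists x0, f x0 <> 0); last first.
  exists 0 => x; have /contrapT -> := f_eq0 x.
  by have := innerZr 0 x 0; rewrite scale0r rmorph0 mul0r => ->.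
have [|v fv vmin] := minimizer.
  by exists ((f x0)^-1 *: x0); rewrite /A/= fZ mulVf//; exact/eqP.
have v0 : v != 0.
  by apply: contra_eq_neq fv => ->; rewrite f0 eq_sym oner_neq0.
have vmin' w : `|f w| * `|v| <= `|w|.
  have [->|fw0] := eqVneq (f w) 0; first by rewrite normr0 mul0r.
  rewrite mulrC -ler_pdivlMr ?normr_gt0// mulrC -normfV -normrZ.
  by apply: vmin; rewrite fZ mulVf.
have ortho k : f k = 0 -> '[k, v] = 0.
  move=> fk; have [->|k0] := eqVneq k 0.
    by have := innerZl 0 0 v; rewrite scale0r mul0r => ->.
  rewrite innerC; suff -> : '[v, k] = 0 by rewrite rmorph0.
  have := vmin' (`|k| ^+ 2 *: v - '[v, k] *: k).
  rewrite fB !fZ fv fk mulr1 mulr0 subr0.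
  rewrite -(@ler_pXn2r _ 2)// ?nnegrE ?mulr_ge0// norm_rejection.
  rewrite [leLHS](_ : _ = `|k| ^+ 2 * (`|v| ^+ 2 * `|k| ^+ 2)); last first.
    by rewrite normrX normr_id; ring.
  rewrite ler_pM2l ?exprn_gt0 ?normr_gt0// lerBrDl gerDr.
  by rewrite -normrX normr_le0 sqrf_eq0 => /eqP.
exists (`|v| ^- 2 *: v) => x.
have /ortho : f (x - f x *: v) = 0 by rewrite fB fZ fv mulr1 subrr.
rewrite innerBl innerZl inner_norm => /eqP; rewrite subr_eq0 => /eqP xv.
rewrite innerZr xv fmorphV rmorphXn/= (conj_Creal (normr_real v)).
by rewrite mulrCA mulVf ?mulr1// expf_eq0 normr_eq0.
Qed.

End Riesz.

Lemma adjoint_exists T : exists S, forall x y, '[T x, y] = '[x, S y].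
Proof.
have /choice[S TS] : forall y, exists v, forall x, '[T x, y] = '[x, v].
  move=> y; apply: (@riesz_representation _ (opnorm T * complex.Re `|y|)).
  - by move=> a x z; rewrite linearP innerDl innerZl.
  - by rewrite mulr_ge0 ?opnorm_ge0// -lecR -normcRe; exact: normr_ge0.
  - move=> x; rewrite (le_trans (cauchy_schwarz _ _))//.
    by rewrite rmorphM/= -normcRe mulrAC ler_wpM2r// opnormP.
have Slin : linear S.
  move=> a x y; apply: inner_eq => z.
  by rewrite -TS !innerDr !innerZr -!TS.
pose S' : {linear H -> H} := HB.pack S (GRing.isLinear.Build _ _ _ _ _ Slin).
have Scont : continuous S.
  apply: (@bounded_linear_continuous _ _ _ S').
  apply/linear_boundedP; near=> r => /= y.
  apply: (@le_trans _ _ (`|T| * `|y|)); last first.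
    by rewrite ler_wpM2r//; near: r; exact: nbhs_pinfty_ge.
  have [->|Sy0] := eqVneq (S y) 0; first by rewrite normr0 mulr_ge0.
  rewrite -(@ler_pM2r _ `|S y|) ?normr_gt0// -expr2 -inner_norm -TS.
  rewrite (le_trans (real_ler_norm _))//.
    by rewrite TS inner_norm rpredX// normr_real.
  by rewrite (le_trans (cauchy_schwarz _ _))// mulrAC ler_wpM2r// opnormP.
have SP : S \in bounded_linear (H := H) by apply/bounded_linearP.
by exists (BoundedOp SP).
Unshelve. all: by end_near. Qed.

(* The default value 0 is never used: see [adjointP]. *)
Definition adjoint T : bounded_op H :=
  xget 0 [set S : bounded_op H | forall x y, '[T x, y] = '[x, S y]].

Lemma adjointP T x y : '[T x, y] = '[x, adjoint T y].
Proof. exact: (xgetPex 0 (adjoint_exists T)). Qed.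

End Adjoint.

Section Spectrum.
Context {R : realType} {H : hilbertType R}.
Implicit Types T : bounded_op H.

Lemma id_bounded_linear : (id : H -> H) \in bounded_linear (H := H).
Proof. by apply/bounded_linearP; split=> [a x y|x]. Qed.

Definition bop_id : bounded_op H := BoundedOp id_bounded_linear.

Definition op_ker T : set H := [set x | T x = 0].

Definition spectrum T : set R[i] :=
  [set l | ~ exists S : bounded_op H,
     cancel (T - l *: bop_id) S /\ cancel S (T - l *: bop_id)].

Definition point_spectrum T : set R[i] :=
  [set l | op_ker (T - l *: bop_id) <> [set 0]].

Definition continuous_spectrum T : set R[i] :=
  spectrum T `\`
    (point_spectrum T `|` [set Num.conj mu | mu in point_spectrum (adjoint T)]).

End Spectrum.

Definition separable_space (T : topologicalType) :=
  exists2 D : set T, countable D & dense D.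

(* Main.v *)
From HB Require Import structures.
Require Import Defs.
From mathcomp Require Import all_boot all_order all_algebra.
From mathcomp Require Import complex.
From mathcomp Require Import all_classical all_reals all_analysis.
From mathcomp Require Import ring lra.

(** Call an operator [A] singular when it is bounded below on no subspace
    [F^perp] with [F] finite.  The set [S T] of the [l] such that [T - l] is
    singular is the left essential spectrum of [T].  Two facts make it useful
    here.

    First, the continuous spectrum lies in [S T]
    ([continuous_spectrum_singular]): if [T - l] is injective and bounded below
    on some [F^perp], it is bounded below on the whole space
    ([injective_bounded_below]); if moreover its adjoint is injective, it is
    then invertible ([bounded_below_surjective], [bop_inverse]).  So it is
    enough to perturb [T] into an operator [T'] such that [S T'] consists of
    eigenvalues of [T'].

    Secondly, a point [l] of [S T] has approximate eigenvectors orthogonal to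
    any given finite set.  Fix [eps > 0] and a finite [eps]-net
    [l_0, ..., l_(N-1)] of the bounded set [S T], the centres being taken in
    [S T].  There is an orthonormal sequence [e] such that [T e_k] is close to
    [l_(k mod N) e_k], with summable errors
    ([orthonormal_approx_eigenvectors]).  Subtracting these errors is adding a
    small compact operator [K]; the [e_k] become exact eigenvectors of [T + K],
    each [l_i] having infinite multiplicity.  Then add [B], which is [eps] times
    a weighted backward shift along each progression [e_i, e_(N+i), ...], with
    weights [(q + 1) / q].  Since these weights are at most 2, [K + B] has norm
    at most [3 eps]; since the products of the first [n] weights are [n + 1],
    with square-summable inverses, the whole closed disc of centre [l_i] and
    radius [eps] is made of eigenvalues of [T' = T + K + B]
    ([disc_in_point_spectrum]).  With the unweighted shift, the points of the
    boundary circle would not be eigenvalues of the shift.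

    Nothing new appears in [S] off these discs ([singular_off_discs]): if
    [|mu - l_i| > eps] for all [i], then [T' - mu] factors as
    [(T + K - mu) (1 + C)], where [C] is [B] followed by the inverse of the
    diagonal operator with entries [l_k - mu].  As the weights tend to 1, [C] is
    a strict contraction on the vectors orthogonal to finitely many [e_k], so
    that [1 + C] is bounded below there, and [mu] in [S T'] gives [mu] in [S T].
    But the discs cover [S T]; hence [S T'] is contained in the union of the
    discs, so in the point spectrum of [T'], and the continuous spectrum of [T']
    is empty. *)

Set Implicit Arguments.
Unset Strict Implicit.
Unset Printing Implicit Defensive.

Import Order.TTheory GRing.Theory Num.Theory.
Import numFieldNormedType.Exports.

Local Open Scope classical_set_scope.
Local Open Scope ring_scope.
Local Open Scope complex_scope.

(** * Real-valued norms and convergence *)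

Section RealNorm.
Context {R : realType} {V : normedZmodType R[i]}.
Implicit Types x y : V.

(** The norms take values in [R[i]], whose order is only partial; working with
    their real parts gives access to the order theory of [R]. *)
Definition rnorm x : R := complex.Re `|x|.

Lemma normE x : `|x| = (rnorm x)%:C.
Proof.
have := normr_ge0 x; rewrite /rnorm; case: `|x| => a b.
by rewrite lecE /= => /andP[/eqP-> _].
Qed.

Lemma rnorm_ge0 x : 0 <= rnorm x.
Proof. by rewrite -lecR -normE; exact: normr_ge0. Qed.

Lemma rnorm_leP x (c : R) : (rnorm x <= c) = (`|x| <= c%:C).
Proof. by rewrite normE lecR. Qed.

Lemma rnorm_ltP x (c : R) : (rnorm x < c) = (`|x| < c%:C).
Proof. by rewrite normE ltcR. Qed.

Lemma rnormD x y : rnorm (x + y) <= rnorm x + rnorm y.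
Proof. by rewrite -lecR rmorphD/= -!normE ler_normD. Qed.

Lemma rnormN x : rnorm (- x) = rnorm x.
Proof. by rewrite /rnorm normrN. Qed.

Lemma rnormBC x y : rnorm (x - y) = rnorm (y - x).
Proof. by rewrite -rnormN opprB. Qed.

Lemma rnormB x y : rnorm (x - y) <= rnorm x + rnorm y.
Proof. by rewrite -(rnormN y) rnormD. Qed.

Lemma rnorm0 : rnorm 0 = 0.
Proof. by rewrite /rnorm normr0. Qed.

Lemma rnorm0_eq0 x : rnorm x = 0 -> x = 0.
Proof. by move=> x0; apply: normr0_eq0; rewrite normE x0. Qed.

Lemma rnorm_gt0 x : (0 < rnorm x) = (x != 0).
Proof. by rewrite -normr_gt0 normE (ltcR 0). Qed.

Lemma rnorm_small_eq0 x : (forall e : R, 0 < e -> rnorm x <= e) -> x = 0.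
Proof.
move=> xe; apply: rnorm0_eq0; apply/eqP; rewrite eq_le rnorm_ge0 andbT.
by apply/ler_addgt0Pr => e e0; rewrite add0r xe.
Qed.

Lemma rnorm_sum (I : Type) (r : seq I) (P : pred I) (F : I -> V) :
  rnorm (\sum_(i <- r | P i) F i) <= \sum_(i <- r | P i) rnorm (F i).
Proof.
apply: (big_ind2 (fun x c => rnorm x <= c)) => //; first by rewrite rnorm0.
by move=> x c y d xc yd; rewrite (le_trans (rnormD _ _))// lerD.
Qed.

End RealNorm.

Section Scalars.
Context {R : realType}.
Implicit Types a b : R[i].

Lemma rnormM a b : rnorm (a * b) = rnorm a * rnorm b.
Proof. by apply: (@complexI R); rewrite rmorphM/= -!normE normrM. Qed.

Lemma rnormV a : rnorm a^-1 = (rnorm a)^-1.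
Proof. by apply: (@complexI R); rewrite fmorphV/= -!normE normfV. Qed.

Lemma rnormX a n : rnorm (a ^+ n) = rnorm a ^+ n.
Proof. by apply: (@complexI R); rewrite rmorphXn/= -!normE normrX. Qed.

Lemma rnorm_real (r : R) : rnorm r%:C = `|r|.
Proof.
apply: (@complexI R).
by rewrite -normE normc_def/= expr0n/= addr0 sqrtr_sqr.
Qed.

Lemma rnormZ (V : normedModType R[i]) a (x : V) :
  rnorm (a *: x) = rnorm a * rnorm x.
Proof. by apply: (@complexI R); rewrite rmorphM/= -!normE normrZ. Qed.

End Scalars.

Section Convergence.
Context {R : realType} {V : normedModType R[i]}.
Implicit Types (u : nat -> V) (l : V).

Lemma cvg_rnormP u l : (u @ \oo --> l) <->
  (forall e : R, 0 < e ->
     exists n, forall m, (n <= m)%N -> rnorm (l - u m) < e).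
Proof.
split=> [/cvgrPdist_lt ul e e0|ul].
  have [n _ un] := ul e%:C (eq_ind_r is_true e0 (ltcR 0 e)).
  by exists n => m nm; rewrite rnorm_ltP; exact: un.
apply/cvgrPdist_lt => -[a b]; rewrite ltcE/= => /andP[/eqP-> a0].
have [n un] := ul a a0.
by exists n => // m /= nm; rewrite -[a +i* 0]/(a%:C) -rnorm_ltP; exact: un.
Qed.

Lemma cvg_rnorm_le u l c :
  u @ \oo --> l -> (forall n, rnorm (u n) <= c) -> rnorm l <= c.
Proof.
move=> /cvg_rnormP ul uc; apply/ler_addgt0Pr => e e0.
have [n un] := ul e e0; rewrite -(subrK (u n) l) (le_trans (rnormD _ _))//.
by rewrite addrC lerD// ltW// un.
Qed.

Lemma cvg_const_near u l (c : V) n :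
  u @ \oo --> l -> (forall m, (n <= m)%N -> u m = c) -> l = c.
Proof.
move=> ul uc; apply/eqP; rewrite -subr_eq0; apply/eqP.
apply: rnorm_small_eq0 => e e0; have /cvg_rnormP/(_ e e0)[k uk] := ul.
by rewrite -(uc (maxn n k)) ?leq_maxl// ltW// uk// leq_maxr.
Qed.

End Convergence.

Lemma cauchy_cvg_rnorm (R : realType) (V : completeNormedModType R[i])
    (u : nat -> V) :
  (forall e : R, 0 < e ->
     exists n, forall m, (n <= m)%N -> rnorm (u m - u n) < e) ->
  exists l : V, u @ \oo --> l.
Proof.
move=> uC; suff uc : cvg (u @ \oo) by exists (lim (u @ \oo)).
apply: cauchy_cvg; apply: cauchy_exP => -[a b].
rewrite ltcE/= => /andP[/eqP-> a0]; have [n un] := uC a a0.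
exists (u n), n => // m /= nm.
by rewrite -ball_normE/= -[a +i* 0]/(a%:C) -rnorm_ltP rnormBC; exact: un.
Qed.

Section InnerProduct.
Context {R : realType} {H : hilbertType R}.
Implicit Types (x y z : H) (A T : bounded_op H).

Lemma inner0l x : inner 0 x = 0.
Proof. by have := innerZl 0 0 x; rewrite scale0r mul0r. Qed.

Lemma inner0r x : inner x 0 = 0.
Proof. by rewrite innerC inner0l rmorph0. Qed.

Lemma inner_suml (I : Type) (r : seq I) (P : pred I) (F : I -> H) y :
  inner (\sum_(i <- r | P i) F i) y = \sum_(i <- r | P i) inner (F i) y.
Proof.
by elim/big_rec2: _ => [|i a b _ <-]; rewrite ?inner0l// innerDl.
Qed.

Lemma inner_sym0 x y : inner x y = 0 -> inner y x = 0.
Proof. by rewrite innerC => /(congr1 Num.conj); rewrite conjCK rmorph0. Qed.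

Lemma rnorm_inner x y : rnorm (inner x y) <= rnorm x * rnorm y.
Proof. by rewrite rnorm_leP rmorphM/= -!normE cauchy_schwarz. Qed.

Lemma rnormE2 x : (rnorm x ^+ 2)%:C = inner x x.
Proof. by rewrite rmorphXn/= -normE inner_norm. Qed.

Lemma pythagoras x y :
  inner x y = 0 -> rnorm (x + y) ^+ 2 = rnorm x ^+ 2 + rnorm y ^+ 2.
Proof.
move=> xy; apply: (@complexI R); rewrite rmorphD/= !rnormE2 innerDl !innerDr xy.
by rewrite (inner_sym0 xy) addr0 add0r.
Qed.

Lemma cvg_inner_const (u : nat -> H) l y c n :
  u @ \oo --> l -> (forall m, (n <= m)%N -> inner (u m) y = c) ->
  inner l y = c.
Proof.
move=> /cvg_rnormP ul uc; apply/eqP; rewrite -subr_eq0; apply/eqP.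
apply: rnorm_small_eq0 => e e0.
have y1 : 0 < rnorm y + 1 by rewrite ltr_wpDl ?rnorm_ge0.
have [k uk] := ul (e / (rnorm y + 1)) (divr_gt0 e0 y1).
rewrite -(uc (maxn n k)) ?leq_maxl// -innerBl.
apply: le_trans (rnorm_inner _ _) _.
have := uk _ (leq_maxr n k); rewrite ltr_pdivlMr// => /ltW; apply: le_trans.
by rewrite ler_wpM2l ?rnorm_ge0// lerDl.
Qed.

Lemma bop_cvg A (u : nat -> H) l :
  u @ \oo --> l -> A (u n) @[n --> \oo] --> A l.
Proof. by move=> ul; apply: continuous_cvg => //; exact: bop_continuous. Qed.

Lemma bop_rnorm A x : rnorm (A x) <= opnorm A * rnorm x.
Proof. by rewrite rnorm_leP rmorphM/= -normE opnormP. Qed.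

Lemma mk_bop (f : H -> H) (C : R) : linear f ->
  (forall x, rnorm (f x) <= C * rnorm x) -> exists A, forall x, A x = f x.
Proof.
move=> flin fC.
pose f' : {linear H -> H} := HB.pack f (GRing.isLinear.Build _ _ _ _ _ flin).
have fcont : continuous f.
  apply: (@bounded_linear_continuous _ _ _ f').
  apply/linear_boundedP; near=> r => /= y.
  apply: (@le_trans _ _ (C%:C * `|y|)).
    by rewrite (normE y) -rmorphM/= -rnorm_leP.
  rewrite ler_wpM2r//; near: r; apply: nbhs_pinfty_ge.
  by rewrite realE (lecR 0) (lecR _ 0) -realE num_real.
have fP : f \in bounded_linear (H := H) by apply/bounded_linearP.
by exists (BoundedOp fP).
Unshelve. all: by end_near. Qed.

Lemma opnorm_le_rnorm A (C : R) :
  0 <= C -> (forall x, rnorm (A x) <= C * rnorm x) -> opnorm A <= C.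
Proof.
move=> C0 AC; apply: opnorm_le => x x1; rewrite -rnorm_leP.
apply: le_trans (AC x) _; rewrite -[leRHS]mulr1 ler_wpM2l//.
by rewrite rnorm_leP.
Qed.

End InnerProduct.

(** * Left essential spectrum and continuous spectrum *)

Section Singular.
Context {R : realType} {H : hilbertType R}.
Implicit Types (x y z w : H) (A T : bounded_op H) (F : seq H).

Definition orth F x := forall f, f \in F -> inner x f = 0.

(** [A] is not left semi-Fredholm.  The strict inequality forces [x] to be
    nonzero. *)
Definition singular A := forall F (d : R), 0 < d ->
  exists2 x, orth F x & rnorm (A x) < d * rnorm x.

Lemma orth_comb F (a : R[i]) x y : orth F x -> orth F y -> orth F (a *: x + y).
Proof. by move=> Fx Fy f fF; rewrite innerDl innerZl Fx// Fy// mulr0 addr0. Qed.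

Lemma orth_cons f F x : orth (f :: F) x <-> inner x f = 0 /\ orth F x.
Proof.
split=> [fFx|[xf Fx] g]; last by rewrite inE => /predU1P[->|/Fx].
by split=> [|g gF]; apply: fFx; rewrite inE ?eqxx ?gF ?orbT.
Qed.

Lemma orth_cat F G x : orth (F ++ G) x <-> orth F x /\ orth G x.
Proof.
split=> [FG|[Fx Gx] g]; last by rewrite mem_cat => /orP[/Fx|/Gx].
by split=> f fF; apply: FG; rewrite mem_cat fF ?orbT.
Qed.

Lemma orth_scale F (a : R[i]) x : orth F x -> orth F (a *: x).
Proof. by move=> Fx f fF; rewrite innerZl Fx// mulr0. Qed.

Lemma singular_unit A F (d : R) : singular A -> 0 < d ->
  exists x, [/\ orth F x, rnorm x = 1 & rnorm (A x) < d].
Proof.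
move=> Asing d0; have [x Fx Axd] := Asing F d d0.
have x0 : 0 < rnorm x.
  by rewrite -(pmulr_rgt0 _ d0) (le_lt_trans (rnorm_ge0 _) Axd).
have nV : rnorm ((rnorm x)^-1%:C : R[i]) = (rnorm x)^-1.
  by rewrite rnorm_real ger0_norm// invr_ge0 ltW.
exists ((rnorm x)^-1%:C *: x); split; first exact: orth_scale.
  by rewrite rnormZ nV mulVf// gt_eqF.
by rewrite linearZ/= rnormZ nV mulrC ltr_pdivrMr.
Qed.

Lemma orth_cvg F (u : nat -> H) l :
  (forall n, orth F (u n)) -> u @ \oo --> l -> orth F l.
Proof.
by move=> Fu ul f fF; apply: (cvg_inner_const (n := 0) ul) => m _; exact: Fu.
Qed.

Lemma inv_nat_small (e : R) : 0 < e -> exists n : nat, n.+1%:R^-1 < e.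
Proof.
move=> e0; have [n en] : exists n : nat, e^-1 < n%:R.
  by exists (Num.truncn e^-1).+1; exact: truncnS_gt.
exists n; rewrite -[e]invrK ltf_pV2 ?posrE ?invr_gt0 ?ltr0n//.
by apply: lt_le_trans en _; rewrite ler_nat.
Qed.

(** One dimension of [F^perp] can be added at a time: split [F^perp] as the line
    of some [w] with [<w, v> = 1] plus [(v :: F)^perp].  If [A w] is at positive
    distance from the image of [(v :: F)^perp], the two lower bounds add up;
    otherwise vectors [w + y_n] have images tending to 0, the [y_n] form a
    Cauchy sequence because [A] is bounded below on [(v :: F)^perp], and their
    limit yields a nonzero vector of the kernel. *)
Lemma bounded_below_remove A v F (C : R) : (forall x, A x = 0 -> x = 0) ->
  0 < C -> (forall x, orth (v :: F) x -> rnorm x <= C * rnorm (A x)) ->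
  exists2 D : R, 0 < D & forall x, orth F x -> rnorm x <= D * rnorm (A x).
Proof.
move=> Ainj C0 lbA.
have [[w Fw wv]|/forall2NP no_w] :=
  pselect (exists2 w, orth F w & inner w v <> 0); last first.
  exists C => // x Fx; apply: lbA; apply/orth_cons; split=> //.
  by have [//|/contrapT] := no_w x.
wlog wv1 : w Fw {wv} / inner w v = 1 => [wlog1|].
  apply: (wlog1 ((inner w v)^-1 *: w)).
    exact: orth_scale.
  by rewrite innerZl mulVf//; exact/eqP.
have [[d d0 dA]|/forall2NP no_d] := pselect (exists2 d : R, 0 < d &
    forall y, orth (v :: F) y -> d <= rnorm (A (w + y))).
  pose W := rnorm (A w); pose D := rnorm w / d + C * (1 + W / d).
  have W0 : 0 <= W := rnorm_ge0 _.
  have D0 : 0 < D.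
    rewrite ltr_wpDl ?divr_ge0 ?rnorm_ge0 ?(ltW d0)// mulr_gt0//.
    by rewrite ltr_pwDl ?divr_ge0 ?(ltW d0).
  exists D => // x Fx.
  pose a := inner x v; pose y := x - a *: w.
  have vFy : orth (v :: F) y.
    apply/orth_cons; split; first by rewrite innerBl innerZl wv1 mulr1 subrr.
    by rewrite /y addrC -scaleNr; exact: orth_comb.
  have xE : x = a *: w + y by rewrite addrC subrK.
  have ad : rnorm a <= rnorm (A x) / d.
    have [->|a0] := eqVneq a 0.
      by rewrite rnorm0 divr_ge0 ?rnorm_ge0 ?(ltW d0).
    rewrite ler_pdivlMr// -[x]scale1r -(divff a0) -scalerA linearZ/= rnormZ.
    rewrite ler_wpM2l ?rnorm_ge0// xE scalerDr scalerA mulVf// scale1r.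
    by apply: dA; exact: orth_scale.
  have Ay : rnorm (A y) <= rnorm (A x) + rnorm a * W.
    by rewrite linearB/= linearZ/= (le_trans (rnormB _ _))// rnormZ.
  have : rnorm y <= C * (rnorm (A x) * (1 + W / d)).
    apply: le_trans (lbA _ vFy) _; rewrite ler_wpM2l ?(ltW C0)//.
    apply: le_trans Ay _; rewrite mulrDr mulr1 lerD2l mulrA mulrAC.
    by rewrite ler_wpM2r.
  have : rnorm (a *: w) <= rnorm (A x) / d * rnorm w.
    by rewrite rnormZ ler_wpM2r ?rnorm_ge0.
  rewrite {3}xE /D => aw yb; apply: le_trans (rnormD _ _) _.
  apply: le_trans (lerD aw yb) _.
  by rewrite le_eqVlt; apply/orP; left; apply/eqP; ring.
have /choice[y yP] : forall n : nat, exists y,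
    orth (v :: F) y /\ rnorm (A (w + y)) < n.+1%:R^-1.
  move=> n; have [|] := no_d n.+1%:R^-1; first by rewrite invr_gt0 ltr0n.
  move=> /existsNP[y /not_implyP[vFy /negP]]; rewrite -ltNge => lty.
  by exists y.
have [l yl] : exists l : H, y @ \oo --> l.
  apply: cauchy_cvg_rnorm => e e0.
  have e2 : 0 < e / (2 * C) by rewrite divr_gt0// mulr_gt0.
  have [n ne] := inv_nat_small e2; exists n => m nm.
  have : orth (v :: F) (y m - y n).
    by rewrite addrC -scaleN1r; apply: orth_comb; [case: (yP n)|case: (yP m)].
  move=> /lbA/le_lt_trans; apply.
  rewrite -ltr_pdivlMl// (_ : y m - y n = (w + y m) - (w + y n)); last first.
    by rewrite opprD addrACA subrr add0r.
  rewrite linearB/= (le_lt_trans (rnormB _ _))//.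
  have [[_ ym] [_ yn]] := (yP m, yP n).
  have mn : m.+1%:R^-1 <= n.+1%:R^-1 :> R.
    by rewrite lef_pV2 ?posrE ?ltr0n// ler_nat.
  have -> : C^-1 * e = e / (2 * C) + e / (2 * C) by field; rewrite gt_eqF.
  apply: le_lt_trans (lerD (ltW ym) (ltW yn)) _.
  apply: le_lt_trans (lerD mn (lexx _)) _.
  by rewrite ltrD.
have vFl : orth (v :: F) l by apply: orth_cvg yl => n; case: (yP n).
have Awl : A (w + l) = 0.
  apply: rnorm_small_eq0 => e e0; have e2 : 0 < e / 2 by rewrite divr_gt0.
  have /cvg_rnormP/(_ _ e2)[n Aln] := bop_cvg (A := A) yl.
  have [k ke] := inv_nat_small e2.
  have := Aln _ (leq_maxl n k); have [_] := yP (maxn n k).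
  have : (maxn n k).+1%:R^-1 <= k.+1%:R^-1 :> R.
    by rewrite lef_pV2 ?posrE ?ltr0n// ler_nat ltnS leq_maxr.
  have := rnormD (A (w + y (maxn n k))) (A l - A (y (maxn n k))).
  rewrite -!linearB -linearD.
  rewrite (_ : w + y _ + _ = w + l); last first.
    by rewrite -addrA [_ + (l - _)]addrC subrK.
  by move: ke => /=; move: (k.+1%:R^-1) ((maxn n k).+1%:R^-1) => p q; lra.
have /orth_cons[lv _] := vFl.
have := Ainj _ Awl => /(congr1 (inner ^~ v)).
by rewrite innerDl wv1 lv addr0 inner0l => /eqP; rewrite oner_eq0.
Qed.

Lemma injective_bounded_below A : (forall x, A x = 0 -> x = 0) ->
  ~ singular A -> exists2 C : R, 0 < C & forall x, rnorm x <= C * rnorm (A x).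
Proof.
move=> Ainj /existsNP[F /existsNP[d /not_implyP[d0 /forall2NP Ad]]].
suff : exists2 C : R, 0 < C & forall x,
    orth [::] x -> rnorm x <= C * rnorm (A x).
  by move=> [C C0 lbA]; exists C => // x; exact: lbA.
have : exists2 C : R, 0 < C & forall x, orth F x -> rnorm x <= C * rnorm (A x).
  exists d^-1; rewrite ?invr_gt0// => x Fx; rewrite ler_pdivlMl//.
  by have [//|/negP] := Ad x; rewrite -leNgt.
elim: F {Ad} => // v F IH [C C0 lbA].
by apply: IH; exact: (bounded_below_remove Ainj C0 lbA).
Qed.

Lemma geometric_cvg (u : nat -> H) (K q : R) : 0 <= K -> 0 <= q -> q < 1 ->
  (forall n, rnorm (u n.+1 - u n) <= K * q ^+ n) -> exists l : H, u @ \oo --> l.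
Proof.
move=> K0 q0 q1 uK; have q1' : 0 < 1 - q by rewrite subr_gt0.
pose L := K / (1 - q).
have L0 : 0 <= L by rewrite divr_ge0 ?(ltW q1').
have uL n k : rnorm (u (n + k)%N - u n) <= L * (q ^+ n - q ^+ (n + k)).
  elim: k => [|k IH]; first by rewrite addn0 !subrr rnorm0 mulr0.
  rewrite addnS -(subrKA (u (n + k)%N)) (le_trans (rnormD _ _))//.
  apply: le_trans (lerD (uK _) IH) _; rewrite exprS.
  rewrite (_ : K = L * (1 - q)); last by rewrite divfK// gt_eqF.
  by rewrite le_eqVlt; apply/orP; left; apply/eqP; ring.
apply: cauchy_cvg_rnorm => e e0.
have [n ne] : exists n, L * q ^+ n < e.
  have L1 : 0 < L + 1 by rewrite ltr_wpDl.
  have q1n : `|q| < 1 by rewrite ger0_norm.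
  have /cvgrPdist_lt/(_ (e / (L + 1)) (divr_gt0 e0 L1))[n _ /(_ n (leqnn n))] :=
    cvg_expr q1n.
  rewrite /= sub0r normrN ger0_norm ?exprn_ge0// ltr_pdivlMr// => qe.
  by exists n; have := exprn_ge0 n q0; nra.
exists n => m nm; rewrite -(subnKC nm) (le_lt_trans (uL _ _))//.
apply: le_lt_trans ne; rewrite ler_wpM2l// gerBl exprn_ge0//.
Qed.

(** The normal equation [A^* A x = A^* y] is solved by iterating
    [x |-> x + t A^* (y - A x)].  With [|A^*| <= M] and [t = M^-2], the operator
    [1 - t A^* A] sends [x] to a vector of squared norm at most
    [|x|^2 - t |A x|^2], so it is a strict contraction because [A] is bounded
    below.  A solution satisfies [A x = y] since [y - A x] is orthogonal to the
    image of [A]. *)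
Lemma bounded_below_surjective A (C : R) :
  (forall x, rnorm x <= C * rnorm (A x)) ->
  (forall y, (forall x, inner (A x) y = 0) -> y = 0) ->
  forall y, exists x, A x = y.
Proof.
move=> lbA Aorth y.
(* Enlarging the constants to be at least 1 ensures [s <= 1], and [1 - s] is
   below the square of [q = 1 - s / 2]. *)
pose B := adjoint A; pose C' : R := Num.max C 1.
pose M : R := opnorm A + opnorm B + 1.
have oA := opnorm_ge0 A; have oB := opnorm_ge0 B.
have M1 : 1 <= M by rewrite /M; lra.
have BM z : rnorm (B z) <= M * rnorm z.
  apply: le_trans (bop_rnorm _ _) _; rewrite ler_wpM2r ?rnorm_ge0//.
  by rewrite /M; lra.
have C'1 : 1 <= C' by rewrite le_max lexx orbT.
have lbA' x : rnorm x <= C' * rnorm (A x).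
  by apply: le_trans (lbA x) _; rewrite ler_wpM2r ?rnorm_ge0// le_max lexx.
pose t : R := (M ^+ 2)^-1; pose s : R := t / C' ^+ 2; pose q : R := 1 - s / 2.
have t0 : 0 < t by rewrite invr_gt0 exprn_gt0// (lt_le_trans ltr01).
have s0 : 0 < s by rewrite divr_gt0// exprn_gt0// (lt_le_trans ltr01).
have s1 : s <= 1.
  rewrite /s /t -invfM invf_le1 ?mulr_gt0 ?exprn_gt0 ?(lt_le_trans ltr01)//.
  by rewrite mulr_ege1// expr_ge1// (le_trans ler01).
have q0 : 0 <= q by rewrite /q; lra.
have q1 : q < 1 by rewrite /q; lra.
have contr x : rnorm (x - t%:C *: B (A x)) <= q * rnorm x.
  rewrite -(@ler_pXn2r _ 2)// ?nnegrE ?rnorm_ge0 ?mulr_ge0 ?rnorm_ge0//.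
  have -> : rnorm (x - t%:C *: B (A x)) ^+ 2 =
      rnorm x ^+ 2 - 2 * t * rnorm (A x) ^+ 2 + t ^+ 2 * rnorm (B (A x)) ^+ 2.
    have nn z : (rnorm z)%:C * (rnorm z)%:C = inner z z.
      by rewrite -rmorphM/= -expr2 rnormE2.
    apply: (@complexI R); rewrite rmorphD rmorphB !rmorphM/= !nn.
    rewrite !(innerBl, innerBr, innerZl, innerZr) (innerC (B (A x)) x).
    rewrite -(adjointP A x (A x)) -innerC.
    by rewrite -[Num.conj t%:C]/(t%:C^*)%C conjc_real; ring.
  have tM : t * M ^+ 2 = 1.
    by rewrite mulVf// gt_eqF// exprn_gt0// (lt_le_trans ltr01).
  have sC : s * C' ^+ 2 = t.
    by rewrite divfK// gt_eqF// exprn_gt0// (lt_le_trans ltr01).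
  have h1 : rnorm (B (A x)) ^+ 2 <= M ^+ 2 * rnorm (A x) ^+ 2.
    rewrite -exprMn lerXn2r ?nnegrE ?rnorm_ge0 ?mulr_ge0 ?rnorm_ge0//.
    exact: le_trans ler01 _.
  have h2 : rnorm x ^+ 2 <= C' ^+ 2 * rnorm (A x) ^+ 2.
    rewrite -exprMn lerXn2r ?nnegrE ?rnorm_ge0 ?mulr_ge0 ?rnorm_ge0//.
    exact: le_trans ler01 _.
  have h3 : t ^+ 2 * rnorm (B (A x)) ^+ 2 <= t * rnorm (A x) ^+ 2.
    rewrite expr2 -mulrA ler_wpM2l ?(ltW t0)//.
    by rewrite -[leRHS]mul1r -tM -mulrA ler_wpM2l ?(ltW t0).
  have h4 : s * rnorm x ^+ 2 <= t * rnorm (A x) ^+ 2.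
    by rewrite -sC -mulrA ler_wpM2l ?(ltW s0).
  have h5 : q ^+ 2 * rnorm x ^+ 2 =
      rnorm x ^+ 2 - s * rnorm x ^+ 2 + (s / 2) ^+ 2 * rnorm x ^+ 2.
    by rewrite /q; field.
  have h6 : 0 <= (s / 2) ^+ 2 * rnorm x ^+ 2 by rewrite mulr_ge0 ?sqr_ge0.
  by rewrite exprMn h5; lra.
pose step x := x + t%:C *: B (y - A x).
pose u n := iter n step 0.
have uS n : u n.+1 - u n = t%:C *: B (y - A (u n)).
  by rewrite /u iterS {1}/step addrC addKr.
have uC n : rnorm (u n.+1 - u n) <= rnorm (u 1%N - u 0%N) * q ^+ n.
  elim: n => [|n IH]; first by rewrite expr0 mulr1.
  have -> : u n.+2 - u n.+1 =
      (u n.+1 - u n) - t%:C *: B (A (u n.+1 - u n)).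
    set r := u n.+1 - u n; have rE : r = _ := uS n.
    rewrite uS {1}rE -scalerBr -linearB/=; congr (_ *: B _).
    by rewrite /r linearB/= opprB addrA subrK.
  apply: le_trans (contr _) _; rewrite exprS mulrCA ler_wpM2l//.
have [x ux] := geometric_cvg (rnorm_ge0 _) q0 q1 uC.
exists x; apply/eqP; rewrite eq_sym -subr_eq0; apply/eqP; apply: Aorth => z.
rewrite adjointP -/B; suff -> : B (y - A x) = 0 by rewrite inner0r.
have t0' : t%:C != 0 :> R[i] by rewrite gt_eqF ?(ltcR 0).
apply: (scalerI t0'); rewrite scaler0; apply: rnorm_small_eq0 => e e0.
have stepx : (fun n => u n.+1 - u n) @ \oo --> t%:C *: B (y - A x).
  under eq_fun do rewrite uS.
  apply: (bop_cvg (A := t%:C *: B)).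
  by apply: cvgB; [exact: cvg_cst|exact: bop_cvg].
have d0 : (fun n => u n.+1 - u n) @ \oo --> (0 : H).
  rewrite -(subrr x); apply: cvgB (ux).
  apply/cvg_rnormP => d d0; have /cvg_rnormP/(_ d d0)[n un] := ux.
  by exists n => m nm; apply: un; exact: leqW.
by rewrite (cvg_unique _ stepx d0)// rnorm0 ltW.
Qed.

Lemma bop_inverse A (C : R) :
  (forall x, rnorm x <= C * rnorm (A x)) -> (forall y, exists x, A x = y) ->
  exists S : bounded_op H, cancel A S /\ cancel S A.
Proof.
move=> lbA /choice[g gA].
have Ainj x x' : A x = A x' -> x = x'.
  move=> xx'; apply/eqP; rewrite -subr_eq0; apply/eqP/rnorm0_eq0.
  apply/eqP; rewrite eq_le rnorm_ge0 andbT (le_trans (lbA _))//.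
  by rewrite linearB/= xx' subrr rnorm0 mulr0.
have glin : linear g.
  by move=> a x y; apply: Ainj; rewrite linearP/= !gA.
have gC x : rnorm (g x) <= C * rnorm x by rewrite -{2}(gA x).
have [S SE] := mk_bop glin gC; exists S.
by split=> x; rewrite SE ?gA//; apply: Ainj; rewrite gA.
Qed.

Lemma point_spectrumP T (l : R[i]) :
  point_spectrum T l <-> exists2 x, x != 0 & T x = l *: x.
Proof.
split=> [|[x x0 Tx] kerT].
  apply: contra_notP => /forall2NP noeig; apply/seteqP; split=> [x /= Tx|_ ->].
    have [/negP/negPn/eqP//|] := noeig x; case.
    by apply/eqP; rewrite -subr_eq0; apply/eqP.
  by have := raddf0 (T - l *: bop_id).
have : op_ker (T - l *: bop_id) x.
  by change (T x - l *: x = 0); rewrite Tx subrr.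
by rewrite kerT /= => /eqP; rewrite (negbTE x0).
Qed.

(** Otherwise the injective operator [T - l] would be bounded below, and the
    injectivity of its adjoint would make it invertible. *)
Lemma continuous_spectrum_singular T (l : R[i]) :
  continuous_spectrum T l -> singular (T - l *: bop_id).
Proof.
move=> [lT /not_orP[lp lps]]; apply: contrapT => nsing; apply: lT.
have opE x : (T - l *: bop_id) x = T x - l *: x by [].
have Ainj x : (T - l *: bop_id) x = 0 -> x = 0.
  rewrite opE => /eqP; rewrite subr_eq0 => /eqP Tx; apply/eqP/negPn/negP => x0.
  by apply: lp; apply/point_spectrumP; exists x.
have [C C0 lbA] := injective_bounded_below Ainj nsing.
apply: (bop_inverse lbA); apply: (bounded_below_surjective lbA) => y yorth.
apply/eqP/negPn/negP => y0; apply: lps; exists (Num.conj l); last exact: conjCK.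
apply/point_spectrumP; exists y => //; apply: inner_eq => x.
have := yorth x; rewrite opE innerBl innerZl adjointP innerZr conjCK.
by move/eqP; rewrite subr_eq0 => /eqP.
Qed.

End Singular.

(** * Operators prescribed on an orthonormal sequence *)

Section Synthesis.
Context {R : realType} {H : hilbertType R}.
Implicit Types (x y : H) (A T : bounded_op H) (e g : nat -> H).

Definition orthonormal_seq e := forall i j, inner (e i) (e j) = (i == j)%:R.

(** On families supported on the indices from [m] on, sending the basis vectors
    of l2 to [g] defines an operator of norm at most [c].  Both orthogonal
    bounded families and summable families satisfy this, so that shifts and
    compact perturbations are built by the same lemma. *)
Definition dominated (m : nat) g (c : R) := forall (a : nat -> R[i]) p q,
  (m <= p)%N ->
  rnorm (\sum_(p <= k < q) a k *: g k) ^+ 2 <=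
    c ^+ 2 * \sum_(p <= k < q) rnorm (a k) ^+ 2.

Lemma orthogonal_sum_rnorm (a : nat -> R[i]) g p q :
  (forall i j, i != j -> inner (g i) (g j) = 0) ->
  rnorm (\sum_(p <= k < q) a k *: g k) ^+ 2 =
    \sum_(p <= k < q) rnorm (a k) ^+ 2 * rnorm (g k) ^+ 2.
Proof.
move=> gorth; have [qp|/ltnW pq] := leqP q p.
  by rewrite !big_geq// rnorm0 expr0n.
rewrite -(subnKC pq); elim: (q - p)%N => [|n IH].
  by rewrite addn0 !big_geq// rnorm0 expr0n.
rewrite addnS !(big_nat_recr (p + n))/= ?leq_addr// pythagoras.
  by rewrite IH rnormZ exprMn.
rewrite inner_suml big_nat_cond big1// => k /andP[/andP[_ kn] _].
by rewrite innerZl innerZr gorth ?mulr0// ltn_eqF.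
Qed.

Lemma dominated_orthogonal m g (c : R) :
  (forall i j, i != j -> inner (g i) (g j) = 0) ->
  (forall k, (m <= k)%N -> rnorm (g k) <= c) -> dominated m g c.
Proof.
move=> gorth gc a p q mp; rewrite orthogonal_sum_rnorm// mulr_sumr.
rewrite big_nat_cond [leRHS]big_nat_cond ler_sum// => k /andP[/andP[pk _] _].
have mk := leq_trans mp pk.
rewrite mulrC ler_wpM2r ?sqr_ge0// lerXn2r ?nnegrE ?rnorm_ge0//.
  by rewrite (le_trans _ (gc k mk))// rnorm_ge0.
exact: gc.
Qed.

(** Each coefficient is at most the l2 norm of the coefficients. *)
Lemma dominated_summable m g (d : nat -> R) (c : R) :
  (forall k, rnorm (g k) <= d k) ->
  (forall p q, (m <= p)%N -> \sum_(p <= k < q) d k <= c) -> dominated m g c.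
Proof.
move=> gd dc a p q mp; set S := \sum_(_ <= _ < _) rnorm _ ^+ 2.
have S0 : 0 <= S by apply: sumr_ge0 => k _; exact: sqr_ge0.
have aS k : (p <= k < q)%N -> rnorm (a k) <= Num.sqrt S.
  move=> /andP[pk kq]; rewrite -[rnorm _]ger0_norm ?rnorm_ge0// -sqrtr_sqr.
  rewrite ler_sqrt// /S (big_cat_nat pk (ltnW kq)) /= (big_ltn kq).
  by rewrite addrCA lerDl addr_ge0// sumr_ge0// => i _; exact: sqr_ge0.
have c0 : 0 <= c by have := dc p p mp; rewrite big_geq.
have bound : rnorm (\sum_(p <= k < q) a k *: g k) <= Num.sqrt S * c.
  apply: le_trans (rnorm_sum _ _ _) _.
  apply: le_trans (_ : Num.sqrt S * \sum_(p <= k < q) d k <= _); last first.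
    by rewrite ler_wpM2l ?sqrtr_ge0// dc.
  rewrite mulr_sumr big_nat_cond [leRHS]big_nat_cond ler_sum// => k.
  by move=> /andP[pkq _]; rewrite rnormZ ler_pM ?rnorm_ge0// aS.
rewrite -(sqr_sqrtr S0) mulrC -exprMn.
by rewrite lerXn2r ?nnegrE ?rnorm_ge0// mulr_ge0 ?sqrtr_ge0.
Qed.

Lemma orthonormal_orth e : orthonormal_seq e ->
  forall i j, i != j -> inner (e i) (e j) = 0.
Proof. by move=> eo i j /negbTE ij; rewrite eo ij. Qed.

Lemma orthonormal_rnorm e : orthonormal_seq e -> forall i, rnorm (e i) = 1.
Proof.
move=> eo i; have : (rnorm (e i) ^+ 2)%:C = 1 :> R[i].
  by rewrite rnormE2 eo eqxx.
move=> /(congr1 (@complex.Re R))/= /eqP.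
by rewrite sqrf_eq1 => /orP[/eqP//|/eqP n1]; have := rnorm_ge0 (e i); lra.
Qed.

Definition psum e g x n := \sum_(0 <= k < n) inner x (e k) *: g k.

(** The partial sum [y] is the orthogonal projection of [x] on the span of the
    first [n] vectors, and [|y| <= |x|]. *)
Lemma bessel e x n : orthonormal_seq e ->
  \sum_(0 <= k < n) rnorm (inner x (e k)) ^+ 2 <= rnorm x ^+ 2.
Proof.
move=> eo; pose y := psum e e x n.
have -> : \sum_(0 <= k < n) rnorm (inner x (e k)) ^+ 2 = rnorm y ^+ 2.
  rewrite /y /psum orthogonal_sum_rnorm; last exact: orthonormal_orth.
  by apply: eq_bigr => k _; rewrite orthonormal_rnorm// expr1n mulr1.
have yj j : (j < n)%N -> inner (e j) (x - y) = 0.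
  move=> jn; apply: inner_sym0; rewrite innerBl inner_suml.
  rewrite (bigD1_seq j) ?mem_index_iota ?iota_uniq//=.
  rewrite innerZl eo eqxx mulr1 big1 ?addr0 ?subrr// => k kj.
  by rewrite innerZl eo (negbTE kj) mulr0.
have {1}-> : x = y + (x - y) by rewrite addrC subrK.
rewrite pythagoras ?lerDl ?sqr_ge0// inner_suml big_nat_cond big1// => k.
by rewrite andbT => /andP[_ kn]; rewrite innerZl yj// mulr0.
Qed.

Lemma nondecreasing_bounded_gap (b : nat -> R) (M d : R) :
  (forall m n, (m <= n)%N -> b m <= b n) -> (forall n, b n <= M) -> 0 < d ->
  exists n, forall m, (n <= m)%N -> b m - b n < d.
Proof.
move=> bnd bM d0; have hs : has_sup (range b).
  by split; [exists (b 0%N), 0%N|exists M => _ [n _ <-]].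
have [_ [n _ <-] nd] := sup_adherent d0 hs; exists n => m nm.
have : b m <= sup (range b) by apply: sup_upper_bound => //; exists m.
by lra.
Qed.

Lemma psum_le e g m (c : R) x n :
  orthonormal_seq e -> 0 <= c -> dominated m g c ->
  (forall k, (k < m)%N -> inner x (e k) = 0) ->
  rnorm (psum e g x n) <= c * rnorm x.
Proof.
move=> eo c0 gc xm.
rewrite -(@ler_pXn2r _ 2)// ?nnegrE ?rnorm_ge0//; last first.
  by rewrite mulr_ge0 ?rnorm_ge0.
rewrite exprMn; apply: le_trans (_ : c ^+ 2 * \sum_(0 <= k < n)
    rnorm (inner x (e k)) ^+ 2 <= _); last first.
  by rewrite ler_wpM2l ?sqr_ge0// bessel.
rewrite /psum; have [nm|/ltnW mn] := leqP n m.
  rewrite big_nat_cond big1 ?rnorm0 ?expr0n/=.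
    by rewrite mulr_ge0 ?sqr_ge0// sumr_ge0// => k _; exact: sqr_ge0.
  by move=> k; rewrite andbT => kn; rewrite xm ?scale0r ?(leq_trans kn).
have cut (V : nmodType) (F : nat -> V) : (forall k, (k < m)%N -> F k = 0) ->
    \sum_(0 <= k < n) F k = \sum_(m <= k < n) F k.
  move=> F0; rewrite (big_cat_nat (leq0n m) mn)/= big_nat_cond big1 ?add0r//.
  by move=> k; rewrite andbT; exact: F0.
rewrite !cut; first exact: gc.
  by move=> k km; rewrite xm// rnorm0 expr0n.
by move=> k km; rewrite xm// scale0r.
Qed.

Definition synthesizes e g A := forall x, psum e g x @ \oo --> A x.

(** By Bessel's inequality the coefficients of [x] are square-summable, so the
    domination of [g] makes the partial sums Cauchy. *)
Lemma synthesis_exists e g (c : R) : orthonormal_seq e -> 0 <= c ->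
  dominated 0 g c -> exists A, synthesizes e g A.
Proof.
move=> eo c0 gc.
have psC x : exists l : H, psum e g x @ \oo --> l.
  apply: cauchy_cvg_rnorm => d d0.
  pose b n := \sum_(0 <= k < n) rnorm (inner x (e k)) ^+ 2.
  have bD m n : (m <= n)%N ->
      b n - b m = \sum_(m <= k < n) rnorm (inner x (e k)) ^+ 2.
    by move=> mn; rewrite /b (big_cat_nat (leq0n m) mn)/= [LHS]addrC addKr.
  have bnd m n : (m <= n)%N -> b m <= b n.
    move=> mn; rewrite -subr_ge0 bD// sumr_ge0// => k _; exact: sqr_ge0.
  have d'0 : 0 < d ^+ 2 / (c ^+ 2 + 1).
    by rewrite divr_gt0 ?exprn_gt0// ltr_wpDl ?sqr_ge0.
  have [n nd] := nondecreasing_bounded_gap bnd (fun n => bessel x n eo) d'0.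
  exists n => m nm; rewrite -(@ltr_pXn2r _ 2)// ?nnegrE ?rnorm_ge0 ?(ltW d0)//.
  rewrite /psum (big_cat_nat (leq0n n) nm)/= [_ + _ - _]addrC addKr.
  apply: le_lt_trans (gc _ _ _ (leq0n n)) _; rewrite -bD//.
  have := nd m nm; rewrite ltr_pdivlMr ?ltr_wpDl ?sqr_ge0//; apply: le_lt_trans.
  by rewrite mulrC ler_wpM2l ?lerDl// subr_ge0 bnd.
have /choice[f fP] := psC.
have flin : linear f.
  move=> a x y; apply: (cvg_unique _ (fP (a *: x + y))) => //.
  have -> : psum e g (a *: x + y) = (fun n => a *: psum e g x n + psum e g y n).
    apply/funext => n; rewrite /psum scaler_sumr -big_split/=.
    by apply: eq_bigr => k _; rewrite innerDl innerZl scalerDl scalerA.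
  by apply: cvgD; [apply: cvgZl_tmp; exact: fP|exact: fP].
have fc x : rnorm (f x) <= c * rnorm x.
  by apply: cvg_rnorm_le (fP x) _ => n; exact: (psum_le _ eo c0 gc).
have [A Af] := mk_bop flin fc.
by exists A => x; rewrite Af.
Qed.

(** Restricted to the vectors orthogonal to the first [m] basis vectors, the
    operator only sees the [g k] with [m <= k]; its norm there can be much
    smaller than on the whole space. *)
Lemma synthesis_tail_le e g A m (c : R) x : orthonormal_seq e ->
  synthesizes e g A -> 0 <= c -> dominated m g c ->
  (forall k, (k < m)%N -> inner x (e k) = 0) -> rnorm (A x) <= c * rnorm x.
Proof.
move=> eo eA c0 gc xm.
by apply: cvg_rnorm_le (eA x) _ => n; exact: (psum_le _ eo c0 gc).
Qed.

Lemma synthesis_basis e g A j : orthonormal_seq e -> synthesizes e g A ->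
  A (e j) = g j.
Proof.
move=> eo eA; apply: (cvg_const_near (n := j.+1) (eA (e j))) => n jn.
rewrite /psum (bigD1_seq j) ?mem_index_iota ?iota_uniq//=.
rewrite eo eqxx scale1r big1 ?addr0// => k kj.
by rewrite eo eq_sym (negbTE kj) scale0r.
Qed.

Lemma synthesis_comp e g A T B x : synthesizes e g A ->
  synthesizes e (fun k => T (g k)) B -> T (A x) = B x.
Proof.
move=> eA eB; apply: (cvg_unique _ _ (eB x)) => //.
have -> : psum e (fun k => T (g k)) x = (fun n => T (psum e g x n)).
  apply/funext => n; rewrite /psum linear_sum/=.
  by apply: eq_bigr => k _; rewrite linearZ.
exact: (bop_cvg (A := T)).
Qed.

(** The vectors are picked recursively, each one in the orthogonal complement of
    its predecessors. *)
Lemma orthonormal_approx_eigenvectors T (l : nat -> R[i]) (d : nat -> R) :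
  (forall k, singular (T - l k *: bop_id)) -> (forall k, 0 < d k) ->
  exists2 e, orthonormal_seq e & forall k, rnorm (T (e k) - l k *: e k) < d k.
Proof.
move=> sing d0.
have /choice[pick pickP] : forall F : seq H, exists x,
    [/\ orth F x, rnorm x = 1 & rnorm (T x - l (size F) *: x) < d (size F)].
  by move=> F; exact: (singular_unit F (sing _) (d0 _)).
(* [L n] lists the first [n] vectors, so that its size tells which eigenvalue
   the next vector must approximate. *)
pose L := fix L n := if n is n'.+1 then pick (L n') :: L n' else [::].
have szL n : size (L n) = n by elim: n => //= n ->.
exists (fun n => pick (L n)); last first.
  by move=> k; have [_ _] := pickP (L k); rewrite szL.
have LP i j : (i < j)%N -> inner (pick (L j)) (pick (L i)) = 0.
  move=> ij; have [+ _ _] := pickP (L j); apply.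
  elim: j ij => // j IH; rewrite ltnS leq_eqVlt => /predU1P[->|/IH ijn] /=.
    by rewrite inE eqxx.
  by rewrite inE ijn orbT.
move=> i j; have [->|] := eqVneq i j.
  by have [_ n1 _] := pickP (L j); rewrite -rnormE2 n1 expr1n.
rewrite neq_ltn => /orP[ij|ji]; last exact: LP.
by apply: inner_sym0; exact: LP.
Qed.

Lemma geometric_tail_le (c : R) m p q : 0 <= c -> (m <= p)%N ->
  \sum_(p <= k < q) c / 2 ^+ k.+1 <= c / 2 ^+ m.
Proof.
move=> c0 mp.
have two k : 0 < 2 ^+ k :> R by rewrite exprn_gt0.
have [qp|/ltnW pq] := leqP q p.
  by rewrite big_geq// divr_ge0 ?(ltW (two m)).
have -> : \sum_(p <= k < q) c / 2 ^+ k.+1 = c / 2 ^+ p - c / 2 ^+ q.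
  rewrite -[RHS]opprB -(telescope_sumr (fun k => c / 2 ^+ k) pq) -sumrN.
  apply: eq_bigr => k _; rewrite opprB exprS; field.
  by rewrite gt_eqF.
apply: le_trans (_ : c / 2 ^+ p <= _).
  by rewrite gerBl divr_ge0 ?(ltW (two q)).
by rewrite ler_wpM2l// lef_pV2 ?posrE// ler_weXn2l// ler1n.
Qed.

End Synthesis.

(** * Finite nets in the plane *)

Section Net.
Context {R : realType}.

Lemma rnorm_ReIm (x : R[i]) :
  rnorm x <= `|complex.Re x| + `|complex.Im x|.
Proof.
case: x => a b /=; rewrite (complexE (a +i* b))/= .
rewrite (le_trans (rnormD _ _))// rnormM !rnorm_real.
suff -> : rnorm ('i%C : R[i]) = 1 by rewrite mul1r.
by rewrite /rnorm normc_def/= expr0n add0r expr1n sqrtr1.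
Qed.

Lemma truncn_eq_dist (h u v : R) : 0 < h -> 0 <= u -> 0 <= v ->
  Num.truncn (u / h) = Num.truncn (v / h) -> `|u - v| <= h.
Proof.
move=> h0 u0 v0 uv.
have /andP[u1 u2] := truncn_itv (divr_ge0 u0 (ltW h0)).
have /andP[v1 v2] := truncn_itv (divr_ge0 v0 (ltW h0)).
move: u1 u2 v1 v2; rewrite uv !ler_pdivlMr// !ltr_pdivrMr// -natr1 mulrDl mul1r.
by rewrite ler_norml => *; apply/andP; split; lra.
Qed.

(** Cut the square [|Re x|, |Im x| <= M] into cells of side [d / 2] and choose a
    point of [X] in each cell that meets [X]; picking the centres in [X] itself
    is essential, since they have to carry approximate eigenvectors. *)
Lemma bounded_finite_net (X : set R[i]) (M d : R) : 0 < d ->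
  (forall x, X x -> rnorm x <= M) ->
  exists2 s : seq R[i], (forall y, y \in s -> X y) &
    forall x, X x -> exists2 y, y \in s & rnorm (x - y) <= d.
Proof.
move=> d0 XM; pose h := d / 2; have h0 : 0 < h by rewrite divr_gt0.
pose cell (x : R[i]) : nat * nat :=
  (Num.truncn ((complex.Re x + M) / h), Num.truncn ((complex.Im x + M) / h)).
pose P := (Num.truncn (2 * M / h)).+1.
have coordM x : X x -> [/\ 0 <= complex.Re x + M, complex.Re x + M <= 2 * M,
    0 <= complex.Im x + M & complex.Im x + M <= 2 * M].
  move=> Xx; have xM := XM x Xx.
  have rex : `|complex.Re x| <= M.
    by apply: le_trans xM; rewrite -lecR -normE; exact: normc_ge_Re.
  have imx : `|complex.Im x| <= M.
    apply: le_trans xM; rewrite -lecR -normE; case: (x) => a b /=; simpc.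
    by rewrite -sqrtr_sqr ler_wsqrtr// lerDr sqr_ge0.
  by move: rex imx; rewrite !ler_norml => /andP[? ?] /andP[? ?]; split; lra.
have small u : 0 <= u -> u <= 2 * M -> (Num.truncn (u / h) < P)%N.
  by move=> u0 uM; rewrite ltnS le_truncn// ler_pM2r ?invr_gt0.
pose rep c := xget 0 [set x | X x /\ cell x = c].
have repP x : X x -> X (rep (cell x)) /\ cell (rep (cell x)) = cell x.
  move=> Xx.
  by apply: (@xgetPex _ 0 [set y | X y /\ cell y = cell x]); exists x.
pose cells := [seq (i, j) | i <- iota 0 P, j <- iota 0 P].
exists [seq rep c | c <- cells & `[< exists2 x, X x & cell x = c >]].
  move=> y /mapP[c]; rewrite mem_filter => /andP[/asboolP[x Xx <-] _] ->.
  by case: (repP x Xx).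
move=> x Xx; have [Xr cr] := repP x Xx; exists (rep (cell x)).
  apply: map_f; rewrite mem_filter; apply/andP; split.
    by apply/asboolP; exists x.
  have [r0 rM i0 iM] := coordM x Xx.
  by apply: allpairs_f; rewrite mem_iota add0n small.
apply: le_trans (rnorm_ReIm _) _; rewrite !raddfB/= (splitr d).
have [r0 _ i0 _] := coordM x Xx; have [r0' _ i0' _] := coordM _ Xr.
case: cr => /esym cr /esym ci; apply: lerD.
  by have := truncn_eq_dist h0 r0 r0' cr; rewrite opprD addrACA subrr addr0.
by have := truncn_eq_dist h0 i0 i0' ci; rewrite opprD addrACA subrr addr0.
Qed.

End Net.

(** * The perturbation *)

Section Shift.
Context {R : realType} {H : hilbertType R}.
Implicit Types (x y : H) (A T : bounded_op H) (e g : nat -> H).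

(** Images of the [e k] under the backward shift by [N] steps with weights [c]:
    for [i < N] it acts on the progression [e i, e (N + i), ...] as a unilateral
    weighted shift killing [e i]. *)
Definition shift_family (N : nat) e (c : nat -> R[i]) (k : nat) : H :=
  if (k < N)%N then 0 else c k *: e (k - N)%N.

Lemma shift_dominated N e c m (C : R) : orthonormal_seq e -> 0 <= C ->
  (forall k, (m <= k)%N -> rnorm (c k) <= C) ->
  dominated m (shift_family N e c) C.
Proof.
move=> eo C0 cC; apply: dominated_orthogonal => [i j ij|k mk].
  rewrite /shift_family; case: (ltnP i N) => [|Ni]; first by rewrite inner0l.
  case: (ltnP j N) => [|Nj]; first by rewrite inner0r.
  rewrite innerZl innerZr (orthonormal_orth eo) ?mulr0//.
  by apply: contra ij => /eqP ij; rewrite -(subnK Ni) ij subnK.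
rewrite /shift_family; case: ifP => _; first by rewrite rnorm0.
by rewrite rnormZ (orthonormal_rnorm eo) mulr1 cC.
Qed.

(** With [q = k %/ N], the weight [(q + 1) / q] of the step from
    [e (q * N + i)] to [e ((q - 1) * N + i)].  For [q = 0], where the shift
    vanishes, its value is 0. *)
Definition weight (N k : nat) : R := (k %/ N).+1%:R / (k %/ N)%:R.

Lemma weight_ge0 N k : 0 <= weight N k.
Proof. by rewrite divr_ge0. Qed.

Lemma weight_le N m k : (0 < N)%N -> (0 < m)%N -> (m * N <= k)%N ->
  weight N k <= 1 + m%:R^-1.
Proof.
move=> N0 m0 mk; have mq : (m <= k %/ N)%N by rewrite leq_divRL.
have q0 : (0 < k %/ N)%N by rewrite (leq_trans m0).
rewrite /weight -natr1 mulrDl mul1r divff ?pnatr_eq0 -?lt0n// lerD2l.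
by rewrite lef_pV2 ?posrE ?ltr0n// ler_nat.
Qed.

Lemma weight_le2 N k : (0 < N)%N -> weight N k <= 2.
Proof.
move=> N0; have [Nk|kN] := leqP N k; last first.
  by rewrite /weight divn_small// invr0 mulr0.
by apply: le_trans (weight_le N0 (ltn0Sn 0) _) _; rewrite ?mul1n// invr1.
Qed.

(** The correction that turns the approximate eigenvectors [e k] of [T] into
    exact ones. *)
Definition diag_family T e (l : nat -> R[i]) (k : nat) : H :=
  l k *: e k - T (e k).

Section Perturbation.
Variables (T : bounded_op H) (N : nat) (l : nat -> R[i]) (e : nat -> H).
Variables (K B : bounded_op H) (eps : R).
Hypotheses (N_gt0 : (0 < N)%N) (lN : forall k, l (k + N)%N = l k).
Hypotheses (eo : orthonormal_seq e) (eps_gt0 : 0 < eps).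
Hypothesis KE : synthesizes e (diag_family T e l) K.
Hypothesis BE :
  synthesizes e (shift_family N e (fun k => (eps * weight N k)%:C)) B.

Let T' := T + (K + B).

Lemma perturbed_basis k :
  T' (e k) = l k *: e k + shift_family N e (fun k => (eps * weight N k)%:C) k.
Proof.
have -> : T' (e k) = T (e k) + (K (e k) + B (e k)) by [].
rewrite (synthesis_basis _ eo KE) (synthesis_basis _ eo BE) addrA.
by rewrite /diag_family [T _ + _]addrC subrK.
Qed.

(** Put [z = (mu - l i) / eps] and [f q = e (q * N + i)].  The vector
    [sum_q z^q / (q + 1) f q] converges for [|z| <= 1], and applying [T' - mu]
    to its partial sums telescopes to a multiple of the last basis vector that
    tends to 0. *)
Lemma disc_in_point_spectrum i (mu : R[i]) : (i < N)%N ->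
  rnorm (mu - l i) <= eps -> point_spectrum T' mu.
Proof.
move=> iN mu_eps.
have epsC : eps%:C != 0 :> R[i] by rewrite gt_eqF ?(ltcR 0).
pose z := (mu - l i) / eps%:C.
have z1 : rnorm z <= 1.
  by rewrite rnormM rnormV rnorm_real gtr0_norm// ler_pdivrMr// mul1r.
have muE : mu = l i + eps%:C * z by rewrite mulrC divfK// addrC subrK.
pose f q := e (q * N + i)%N.
have fo : orthonormal_seq f.
  move=> p q; rewrite eo; congr (_%:R); congr nat_of_bool.
  by rewrite eqn_add2r eqn_pmul2r.
pose c q : R[i] := z ^+ q / q.+1%:R.
have cle q : rnorm (c q) <= q.+1%:R^-1.
  rewrite rnormM rnormV rnormX -(rmorph_nat (real_complex R)) rnorm_real.
  rewrite ger0_norm// -[leRHS]mul1r ler_wpM2r ?invr_ge0//.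
  by rewrite exprn_ile1// rnorm_ge0.
pose v n := \sum_(0 <= q < n) c q *: f q.
have vn m n : (0 < m <= n)%N -> rnorm (v n - v m) ^+ 2 <= m%:R^-1.
  move=> /andP[m0 mn]; rewrite /v (big_cat_nat (leq0n m) mn)/=.
  rewrite [X in rnorm X]addrC addKr.
  rewrite orthogonal_sum_rnorm; last exact: orthonormal_orth.
  apply: le_trans (_ : \sum_(m <= q < n) (q%:R^-1 - q.+1%:R^-1 : R) <= _).
    rewrite big_nat_cond [leRHS]big_nat_cond ler_sum// => q.
    rewrite andbT => /andP[mq _]; have q0 : (0 < q)%N := leq_trans m0 mq.
    have q0' : 0 < q%:R :> R by rewrite ltr0n.
    rewrite (orthonormal_rnorm fo) expr1n mulr1.
    apply: le_trans (_ : q.+1%:R^-1 ^+ 2 <= _).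
      by rewrite lerXn2r ?nnegrE ?rnorm_ge0 ?invr_ge0.
    have -> : q%:R^-1 - q.+1%:R^-1 = q%:R^-1 * q.+1%:R^-1 :> R.
      by rewrite -natr1; field; rewrite !gt_eqF// ltr_wpDl// ltW.
    by rewrite expr2 ler_wpM2r ?invr_ge0// lef_pV2 ?posrE ?ltr0n// ler_nat.
  rewrite (_ : \sum_(m <= q < n) _ = m%:R^-1 - n%:R^-1 :> R).
    by rewrite gerBl invr_ge0.
  rewrite -[RHS]opprB -(telescope_sumr (fun q => q%:R^-1) mn) -sumrN.
  by apply: eq_bigr => q _; rewrite opprB.
have [w vw] : exists w : H, v @ \oo --> w.
  apply: cauchy_cvg_rnorm => d d0.
  have d20 : 0 < d ^+ 2 by rewrite exprn_gt0.
  have [n nd] := inv_nat_small d20; exists n.+1 => m nm.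
  rewrite -(@ltr_pXn2r _ 2)// ?nnegrE ?rnorm_ge0 ?(ltW d0)//.
  by apply: le_lt_trans nd; exact: vn.
pose A := T' - mu *: bop_id.
have AE x : A x = T' x - mu *: x by [].
have AZ a x : A (a *: x) = a *: A x by exact: linearZ.
have AD x y : A (x + y) = A x + A y by exact: linearD.
have Avn n : A (v n.+1) = - (eps%:C * z ^+ n.+1 / n.+1%:R) *: f n.
  have Af q : A (f q) = - (eps%:C * z) *: f q +
      (if q is q'.+1 then (eps%:C * (q'.+2%:R / q'.+1%:R)) *: f q' else 0).
    rewrite AE perturbed_basis; have -> : l (q * N + i)%N = l i.
      by elim: q => [|q IH]; rewrite ?mul0n// mulSn -addnA addnC lN.
    rewrite addrAC -scalerBl; congr (_ *: _ + _).
      by rewrite muE opprD addrA subrr add0r.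
    rewrite /shift_family; case: q => [|q]; first by rewrite mul0n add0n iN.
    rewrite mulSn -addnA ltnNge leq_addr/= addKn; congr (_ *: _).
    rewrite /weight divnDl ?dvdnn// divnn N_gt0 divnMDl// divn_small//.
    rewrite addn0 add1n.
    by rewrite rmorphM rmorphM/= fmorphV/= !rmorph_nat.
  elim: n => [|n IH].
    rewrite /v big_nat1 AZ Af addr0 scalerA; congr (_ *: _).
    by rewrite /c expr0 expr1 !divr1 mul1r.
  rewrite {1}/v big_nat_recr// -/(v n.+1) AD AZ IH Af.
  rewrite scalerDr !scalerA addrCA -scalerDl /c.
  have n1 : (n.+1%:R : R[i]) != 0 by rewrite pnatr_eq0.
  have n2 : (n.+2%:R : R[i]) != 0 by rewrite pnatr_eq0.
  rewrite [X in _ + X *: _](_ : _ = 0) ?scale0r ?addr0; last first.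
    by move: (n.+1%:R) (n.+2%:R) n1 n2 => a b a0 b0; field; rewrite a0 b0.
  congr (_ *: _).
  by rewrite (exprS z n.+1) mulrN mulrCA !mulrA; congr (- _); ring.
apply/point_spectrumP; exists w.
  apply/eqP => w0; have : inner w (f 0%N) = 1.
    apply: (cvg_inner_const (n := 1%N) vw) => -[//|m] _.
    rewrite /v big_nat_recl// innerDl innerZl fo /c expr0 divr1 mulr1.
    by rewrite inner_suml big1 ?addr0// => q _; rewrite innerZl fo mulr0.
  by rewrite w0 inner0l => /esym/eqP; rewrite oner_eq0.
apply/eqP; rewrite -subr_eq0 -AE; apply/eqP.
apply: rnorm_small_eq0 => d d0; have d20 : 0 < d / 2 by rewrite divr_gt0.
have /cvg_rnormP/(_ _ d20)[n vn'] := bop_cvg (A := A) vw.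
have [k kd] := inv_nat_small (divr_gt0 d20 eps_gt0).
pose m := maxn n k.
have Avm : rnorm (A (v m.+1)) <= d / 2.
  rewrite Avn rnormZ (orthonormal_rnorm fo) mulr1 rnormN.
  rewrite rnormM rnormM rnormV rnormX.
  rewrite rnorm_real -(rmorph_nat (real_complex R)) rnorm_real.
  rewrite !ger0_norm ?(ltW eps_gt0)//.
  apply: le_trans (_ : eps * k.+1%:R^-1 <= _).
    rewrite -mulrA ler_wpM2l ?(ltW eps_gt0)// -[leRHS]mul1r.
    rewrite ler_pM ?invr_ge0 ?exprn_ge0 ?rnorm_ge0// ?exprn_ile1 ?rnorm_ge0//.
    by rewrite lef_pV2 ?posrE ?ltr0n// ler_nat ltnS leq_maxr.
  by rewrite mulrC -ler_pdivlMr// ltW.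
rewrite -(subrK (A (v m.+1)) (A w)) (le_trans (rnormD _ _))// (splitr d).
by rewrite lerD// ltW// vn'// leqW// leq_maxl.
Qed.

(** Here [D = T + K - mu] is diagonal on the [e k], and [C] divides the weights
    of [B] by [l k - mu], so that [D C = B] and [T' - mu = D (1 + C)].  Testing
    the singularity of [T' - mu] on vectors [x] orthogonal to enough [e k] and
    such that [(1 + C) x] is orthogonal to [F] and to enough [e k], both
    [|C x| <= s |x|] with [s < 1] and [|K (1 + C) x|] small hold, so that
    [(1 + C) x] shows the singularity of [T - mu]. *)
Lemma singular_off_discs (eta r : R) (mu : R[i]) : 0 <= eta ->
  (forall k, rnorm (diag_family T e l k) <= eta / 2 ^+ k.+1) ->
  0 <= r -> r < 1 -> (forall k, eps <= r * rnorm (l k - mu)) ->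
  singular (T' - mu *: bop_id) -> singular (T - mu *: bop_id).
Proof.
move=> eta0 gK r0 r1 lmu sing F d d0.
have lmu0 k : l k - mu != 0.
  rewrite -rnorm_gt0 lt_neqAle rnorm_ge0 andbT eq_sym; apply/eqP => l0.
  by have := lmu k; rewrite l0 mulr0 leNgt eps_gt0.
pose c k := (eps * weight N k)%:C / (l k - mu).
have cle k (C : R) : weight N k <= C -> rnorm (c k) <= r * C.
  move=> wC; rewrite rnormM rnormV rnorm_real ger0_norm; last first.
    by rewrite mulr_ge0 ?(ltW eps_gt0)// weight_ge0.
  rewrite ler_pdivrMr ?rnorm_gt0// mulrAC ler_pM ?(ltW eps_gt0) ?weight_ge0//.
pose s := (1 + r) / 2.
have s1 : s < 1 by rewrite /s; lra.
have s0 : 0 <= s by rewrite /s; lra.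
have [m m0 ms] : exists2 m : nat, (0 < m)%N & r * (1 + m%:R^-1) <= s.
  have r2 : 0 < (1 - r) / 2 by lra.
  have [m mr] := inv_nat_small r2.
  exists m.+1 => //; rewrite mulrDr mulr1 /s.
  have : r * m.+1%:R^-1 <= m.+1%:R^-1 by rewrite ler_piMl ?invr_ge0// ltW.
  by move: mr => /=; move: (m.+1%:R^-1) => t; lra.
have ctail : dominated (m * N) (shift_family N e c) s.
  apply: shift_dominated => // k mk; apply: le_trans ms.
  by apply: cle; exact: weight_le.
have cdom : dominated 0 (shift_family N e c) (r * 2).
  apply: shift_dominated => //; first by rewrite mulr_ge0.
  by move=> k _; apply: cle; exact: weight_le2.
have rr : 0 <= r * 2 by rewrite mulr_ge0.
have [C CE] := synthesis_exists eo rr cdom.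
pose W : bounded_op H := bop_id + C.
have WE x : W x = x + C x by [].
pose D := T + K - mu *: bop_id.
have DE x : D x = T x + K x - mu *: x by [].
have De k : D (e k) = (l k - mu) *: e k.
  by rewrite DE (synthesis_basis _ eo KE) /diag_family [T _ + _]addrC subrK
    scalerBl.
have DC x : D (C x) = B x.
  apply: synthesis_comp CE _.
  suff -> : (fun k => D (shift_family N e c k)) =
      shift_family N e (fun k => (eps * weight N k)%:C) by [].
  apply/funext => k; rewrite /shift_family.
  case: ltnP => [_|Nk]; first exact: raddf0.
  have -> : D (c k *: e (k - N)%N) = c k *: D (e (k - N)%N) by exact: linearZ.
  by rewrite De scalerA -(lN (k - N)%N) subnK// divfK.
have DW x : D (W x) = (T' - mu *: bop_id) x.
  rewrite WE; have -> : D (x + C x) = D x + D (C x) by exact: linearD.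
  rewrite DC DE.
  change (T x + K x - mu *: x + B x = T x + (K x + B x) - mu *: x).
  by rewrite addrAC addrA.
have [p pd] : exists p, eta / 2 ^+ p <= d / 2.
  have de : 0 < d / 2 / (eta + 1) by rewrite !divr_gt0// ltr_wpDl.
  have [p pd] := inv_nat_small de.
  exists p.+1; move: pd; rewrite ltr_pdivlMr ?ltr_wpDl// => /ltW.
  apply: le_trans; rewrite mulrC ler_pM ?invr_ge0 ?exprn_ge0 ?lerDl//.
  rewrite lef_pV2 ?posrE ?ltr0n ?exprn_gt0// -natrX ler_nat.
  by rewrite ltnW// ltn_expl.
have Ktail : dominated p (diag_family T e l) (eta / 2 ^+ p).
  apply: dominated_summable gK _ => p' q pp'.
  exact: geometric_tail_le.
(* Orthogonality of [W x] to a vector is orthogonality of [x] to its image under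
   the adjoint of [W]. *)
pose G := map (adjoint W) (F ++ map e (iota 0 p)) ++ map e (iota 0 (m * N)).
have sd0 : 0 < (1 - s) * (d / 2) by rewrite mulr_gt0 ?subr_gt0 ?divr_gt0.
have [x Gx xd] := sing G _ sd0.
have /orth_cat[GWx Gex] := Gx.
have /orth_cat[FWx eWx] : orth (F ++ map e (iota 0 p)) (W x).
  by move=> f fF; rewrite adjointP GWx//; exact: map_f.
have Cx : rnorm (C x) <= s * rnorm x.
  apply: synthesis_tail_le CE s0 ctail _ => // k km.
  by apply: Gex; apply: map_f; rewrite mem_iota.
have KWx : rnorm (K (W x)) <= d / 2 * rnorm (W x).
  apply: le_trans (_ : eta / 2 ^+ p * rnorm (W x) <= _); last first.
    by rewrite ler_wpM2r ?rnorm_ge0.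
  apply: synthesis_tail_le KE _ Ktail _ => // [|k kp].
    by rewrite divr_ge0 ?exprn_ge0.
  by apply: eWx; apply: map_f; rewrite mem_iota.
exists (W x) => //.
have Wge : (1 - s) * rnorm x <= rnorm (W x).
  have := rnormB (W x) (C x); rewrite {1}WE addrK; lra.
have -> : (T - mu *: bop_id) (W x) = D (W x) - K (W x).
  change (T (W x) - mu *: W x = T (W x) + K (W x) - mu *: W x - K (W x)).
  by rewrite addrAC addrK.
apply: le_lt_trans (rnormB _ _) _; rewrite DW.
apply: lt_le_trans (ltr_leD xd KWx) _.
have d20 : 0 < d / 2 by rewrite divr_gt0.
by nra.
Qed.

End Perturbation.
End Shift.

(** * Density *)

Section Density.
Context {R : realType} {H : hilbertType R}.
Implicit Types T : bounded_op H.

Lemma singular_bounded T (mu : R[i]) :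
  singular (T - mu *: bop_id) -> rnorm mu <= opnorm T + 1.
Proof.
move=> sing; have [x [_ x1 xT]] := singular_unit [::] sing ltr01.
have Tx := bop_rnorm T x.
have : rnorm (mu *: x) <= rnorm (T x) + rnorm (T x - mu *: x).
  by rewrite -{1}(subKr (T x) (mu *: x)) rnormB.
by rewrite rnormZ; move: Tx xT; rewrite x1 !mulr1; lra.
Qed.

Lemma continuous_spectrum_perturbation T (d : R) : 0 < d ->
  exists2 T', opnorm (T' - T) < d & continuous_spectrum T' = set0.
Proof.
move=> d0.
have [eps eps0 epsd] : exists2 eps : R, 0 < eps & eps * 3 < d.
  by exists (d / 4); [rewrite divr_gt0|lra].
have [s sS Snet] := bounded_finite_net eps0 (@singular_bounded T).
have [s0|N0] := posnP (size s).
  exists T; first by by rewrite subrr -ltcR -bop_normE normr0 (ltcR 0).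
  apply/seteqP; split=> // mu /continuous_spectrum_singular/Snet[y].
  by rewrite (size0nil s0).
set N := size s in N0; pose l k := s`_(k %% N).
have lS k : singular (T - l k *: bop_id).
  by apply: sS; rewrite mem_nth// ltn_pmod.
have lN k : l (k + N)%N = l k by rewrite /l modnDr.
have [e eo ed] := orthonormal_approx_eigenvectors lS
  (fun k => divr_gt0 eps0 (exprn_gt0 k.+1 (ltr0Sn R 1))).
have gK k : rnorm (diag_family T e l k) <= eps / 2 ^+ k.+1.
  by rewrite rnormBC ltW// ed.
have Kdom : dominated 0 (diag_family T e l) eps.
  apply: dominated_summable gK _ => p q _.
  apply: le_trans (geometric_tail_le _ (ltW eps0) (leq0n p)) _.
  by rewrite expr0 divr1.
have [K KE] := synthesis_exists eo (ltW eps0) Kdom.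
have Bdom : dominated 0
    (shift_family N e (fun k => (eps * weight N k)%:C)) (eps * 2).
  apply: shift_dominated => // [|k _]; first by rewrite mulr_ge0// ltW.
  rewrite rnorm_real ger0_norm ?mulr_ge0 ?weight_ge0 ?(ltW eps0)//.
  by rewrite ler_wpM2l ?weight_le2// ltW.
have [B BE] := synthesis_exists eo (mulr_ge0 (ltW eps0) (ler0n R 2)) Bdom.
exists (T + (K + B)).
  rewrite addrC addKr.
  have KBle x : rnorm ((K + B) x) <= (eps * 3) * rnorm x.
    apply: le_trans (rnormD (K x) (B x)) _.
    rewrite (_ : 3 = 1 + 2)// mulrDr mulr1 mulrDl lerD//.
      by apply: (synthesis_tail_le eo KE (ltW eps0) (m := 0)).
    apply: (synthesis_tail_le eo BE _ (m := 0)) => //.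
    by rewrite mulr_ge0// ltW.
  apply: le_lt_trans (opnorm_le_rnorm _ KBle) epsd.
  by rewrite mulr_ge0// ltW.
apply/seteqP; split=> // mu muc.
have mup i : (i < N)%N -> eps < rnorm (mu - l i).
  move=> iN; rewrite ltNge; apply/negP => mui.
  case: muc => _; apply; left.
  exact: (disc_in_point_spectrum N0 lN eo eps0 KE BE iN mui).
have sing' := continuous_spectrum_singular muc.
have lmod k : l k = l (k %% N)%N by rewrite /l modn_mod.
(* Finitely many strict inequalities [eps < |mu - l i|] hold with a common
   ratio below 1. *)
have [r [r0 r1 rl]] : exists r : R, [/\ 0 <= r, r < 1 &
    forall k, eps <= r * rnorm (l k - mu)].
  exists (\big[Num.max/0]_(i < N) (eps / rnorm (mu - l i))); split.
  - exact: bigmax_ge_id.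
  - apply: bigmax_lt => // i _; have := mup i (ltn_ord i).
    by move=> mui; rewrite ltr_pdivrMr ?mul1r// (lt_trans eps0).
  move=> k; have kN : (k %% N < N)%N by rewrite ltn_pmod.
  rewrite lmod rnormBC -ler_pdivrMr ?(lt_trans eps0 (mup _ kN))//.
  exact: (le_bigmax _ (fun i : 'I_N => eps / rnorm (mu - l i)) (Ordinal kN)).
have /Snet[y ys] :=
  singular_off_discs N0 lN eo eps0 KE BE (ltW eps0) gK r0 r1 rl sing'.
have := mup (index y s); rewrite index_mem => /(_ ys).
by rewrite /l modn_small ?index_mem// nth_index// ltNge => /negbTE->.
Qed.

End Density.

Theorem theorem1p3 (R : realType) (H : hilbertType R)
    (sepH : separable_space H) :
  dense [set T : bounded_op H | continuous_spectrum T = set0].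
Proof.
move=> O [T OT] Oopen.
have /nbhs_ballP[[a b]] := open_nbhs_nbhs (conj Oopen OT).
rewrite /= ltcE/= => /andP[/eqP-> a0] ballO.
have [T' T'T T'c] := continuous_spectrum_perturbation T a0.
exists T'; split=> //; apply: ballO.
by rewrite -ball_normE/= distrC bop_normE -[a +i* 0]/(a%:C) ltcR.
Qed.
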